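(* Let $\Omega\subset\mathbb{R}^2$ be a bounded open Lipschitz domain, $\alpha\in(0,1)$, $\epsilon>0$, $T>0$, and let $u_-<u_m<u_+$ be real numbers. Let $u$ be the solution of $$\partial_t u=-\epsilon^2(-\Delta)^\alpha u-\mathcal{N}(u),\quad (x,t)\in\Omega\times(0,T],\qquad u|_{\partial\Omega}=0,$$ with $\mathcal{N}(u)=u\,(u+u_--u_m)(u+u_--u_+)$ and initial condition $u_0(x):=u(x,0)$, $u_0\in C_0(\Omega)$. If $0\le u_0(x)\le u_+-u_-$ for all $x\in\Omega$, then $0\le u(x,t)\le u_+-u_-$ for all $(x,t)\in\overline P$, where $P=\Omega\times(0,T]$.
   Context: $C_0(\Omega)=\{u\in C(\overline\Omega): u=0 \text{ on }\partial\Omega\}$ with the sup norm. Let $\{(\lambda_k,\varphi_k)\}_{k\ge1}$ be the Dirichlet eigenpairs of $-\Delta$ on $\Omega$, with $\{\varphi_k\}$ an orthonormal basis of $L^2(\Omega)$, and $u_k=\int_\Omega u\varphi_k\,dx$. The spectral fractional Laplacian is $(-\Delta)^\alpha u=\sum_k\lambda_k^\alpha u_k\varphi_k$, with domain $\mathbb{H}^{2\alpha}(\Omega)=\{u\in L^2(\Omega):\sum_k\lambda_k^{2\alpha}|u_k|^2<\infty\}$. The solution on $[0,T]$ is $u\in C([0,T],C_0(\Omega))$ satisfying the Duhamel formula $u(t)=Q(t)u_0-\int_0^tQ(t-s)\mathcal{N}(u(s))\,ds$ with $Q(t)=e^{-\epsilon^2(-\Delta)^\alpha t}$; equivalently $u\in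 C([0,T],C_0(\Omega))\cap C((0,T],\mathbb{H}^{2\alpha}(\Omega))\cap C^1((0,T],C_0(\Omega))$ satisfies the equation for $t\in(0,T]$ with $u(0)=u_0$. *)

(* Defs.v *)
From HB Require Import structures.
From mathcomp Require Import all_boot all_order all_algebra.
From mathcomp Require Import all_classical all_reals all_analysis.
Set Implicit Arguments.
Unset Strict Implicit.
Unset Printing Implicit Defensive.
Import Order.TTheory GRing.Theory Num.Theory.
Import numFieldNormedType.Exports.
Local Open Scope classical_set_scope.
Local Open Scope ring_scope.

(** * Lipschitz domains of the plane *)

Definition boundary {X : topologicalType} (A : set X) : set X :=
  closure A `\` A°.

(* Near every boundary point, in the coordinates rotated by the unit vector
   (a, b), the set is the part of the plane lying strictly above the graph of a
   globally Lipschitz function.  [ball] is the sup-norm ball of R * R. *)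
Definition lipschitz_boundary {R : realType} (Omega : set (R * R)) : Prop :=
  forall p, boundary Omega p ->
    exists (r a b k : R) (gamma : R -> R),
      [/\ 0 < r, a ^+ 2 + b ^+ 2 = 1, k.-lipschitz gamma
        & forall x : R * R, ball p r x ->
            (Omega x <-> gamma (a * x.1 + b * x.2) < a * x.2 - b * x.1)].

Definition bounded_lipschitz_domain {R : realType} (Omega : set (R * R)) : Prop :=
  [/\ open Omega, Omega !=set0, connected Omega, bounded_set Omega
    & lipschitz_boundary Omega].

(** * L^2(Omega)

    Elements of L^2(Omega) are represented by functions on the plane whose values
    off Omega are irrelevant; equality in L^2(Omega) is equality a.e. on Omega. *)

Definition mu2 (R : realType) :
    {measure set (measurableTypeR R * measurableTypeR R) -> \bar R} :=
  (@lebesgue_measure R \x @lebesgue_measure R)%E.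

Definition L2 {R : realType} (Omega : set (R * R)) (f : R * R -> R) : Prop :=
  (f \_ Omega) \in Lfun (mu2 R) 2%:E.

Definition L2norm {R : realType} (Omega : set (R * R)) (f : R * R -> R) : \bar R :=
  'N[mu2 R]_(2%:E)[EFin \o (f \_ Omega)].

Definition L2cvg {R : realType} (Omega : set (R * R))
    (f_ : nat -> R * R -> R) (f : R * R -> R) : Prop :=
  L2norm Omega (fun x => f_ n x - f x) @[n --> \oo] --> 0%E.

Definition L2inner {R : realType} (Omega : set (R * R)) (f g : R * R -> R) : R :=
  Rintegral (mu2 R) Omega (fun x => f x * g x).

(** * H^1_0(Omega) *)

Definition axis {R : realType} (i : bool) : R * R := if i then (0, 1) else (1, 0).

Definition pd {R : realType} (i : bool) (f : R * R -> R) : R * R -> R :=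
  fun x => 'D_(axis i) f x.

Definition smooth {R : realType} (f : R * R -> R) : Prop :=
  forall s : seq bool,
    continuous (foldr pd f s) /\
    forall i x, derivable (foldr pd f s) x (axis i).

Definition test_function {R : realType} (Omega : set (R * R)) (psi : R * R -> R) :
    Prop :=
  [/\ smooth psi, compact (closure [set x | psi x != 0])
    & closure [set x | psi x != 0] `<=` Omega].

Definition weak_grad {R : realType} (Omega : set (R * R)) (f : R * R -> R)
    (g : bool -> R * R -> R) : Prop :=
  forall i, L2 Omega (g i) /\
    forall psi, test_function Omega psi ->
      L2inner Omega f (pd i psi) = - L2inner Omega (g i) psi.

(* The closure of the test functions in the norm of H^1(Omega). *)
Definition H10 {R : realType} (Omega : set (R * R)) (f : R * R -> R) : Prop :=
  L2 Omega f /\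
  exists2 g : bool -> R * R -> R, weak_grad Omega f g &
    exists psi : nat -> R * R -> R,
      [/\ forall n, test_function Omega (psi n),
          L2cvg Omega psi f
        & forall i, L2cvg Omega (fun n => pd i (psi n)) (g i)].

(** * Dirichlet eigenpairs and the operators they diagonalize *)

Definition dirichlet_eigenpair {R : realType} (Omega : set (R * R))
    (lam : R) (phi : R * R -> R) : Prop :=
  [/\ H10 Omega phi,
      ~ {ae mu2 R, forall x, Omega x -> phi x = 0}
    & forall v gphi gv, H10 Omega v ->
        weak_grad Omega phi gphi -> weak_grad Omega v gv ->
        L2inner Omega (gphi false) (gv false) + L2inner Omega (gphi true) (gv true)
          = lam * L2inner Omega phi v].

Definition orthonormal_basis {R : realType} (Omega : set (R * R))
    (phi : nat -> R * R -> R) : Prop :=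
  [/\ forall k, L2 Omega (phi k),
      forall j k, L2inner Omega (phi j) (phi k) = (j == k)%:R
    & forall f, L2 Omega f ->
        L2cvg Omega
          (fun n x => \sum_(k < n) L2inner Omega f (phi k) * phi k x) f].

Definition dirichlet_eigenbasis {R : realType} (Omega : set (R * R))
    (lam : nat -> R) (phi : nat -> R * R -> R) : Prop :=
  (forall k, dirichlet_eigenpair Omega (lam k) (phi k)) /\
  orthonormal_basis Omega phi.

(* [g] is the value at [f] of the operator with eigenpairs (m k, phi k), that is
   g = \sum_k m k <f, phi k> phi k, the series converging in L^2(Omega). *)
Definition diag_op {R : realType} (Omega : set (R * R)) (phi : nat -> R * R -> R)
    (m : nat -> R) (f g : R * R -> R) : Prop :=
  L2 Omega g /\
  L2cvg Omega
    (fun n x => \sum_(k < n) m k * L2inner Omega f (phi k) * phi k x) g.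

(* The spectral fractional Laplacian (-Delta)^alpha is
   [diag_op Omega phi (frac_eigenvalue lam alpha)]. *)
Definition frac_eigenvalue {R : realType} (lam : nat -> R) (alpha : R) (k : nat) : R :=
  lam k `^ alpha.

(* [g] represents Q(t) f, where Q(t) = exp (- eps^2 (-Delta)^alpha t). *)
Definition is_semigroup {R : realType} (Omega : set (R * R))
    (lam : nat -> R) (phi : nat -> R * R -> R) (alpha eps t : R)
    (f g : R * R -> R) : Prop :=
  diag_op Omega phi
    (fun k => expR (- (eps ^+ 2 * frac_eigenvalue lam alpha k * t))) f g.

(* Riemann integral of an L^2(Omega)-valued function over [a, b]: the sums over
   all tagged partitions converge in L^2(Omega) as the mesh tends to 0. *)
Definition is_L2_integral {R : realType} (Omega : set (R * R))
    (F : R -> R * R -> R) (a b : R) (I : R * R -> R) : Prop :=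
  L2 Omega I /\
  forall e : R, 0 < e -> exists2 d : R, 0 < d &
    forall (n : nat) (tau xi : nat -> R),
      tau 0%N = a -> tau n = b ->
      (forall i, (i < n)%N ->
         tau i <= xi i <= tau i.+1 /\ tau i.+1 - tau i < d) ->
      (L2norm Omega
         (fun x => \sum_(i < n) (tau i.+1 - tau i) * F (xi i) x - I x)%R < e%:E)%E.

(** * The Allen-Cahn equation *)

Definition C0 {R : realType} (Omega : set (R * R)) (f : R * R -> R) : Prop :=
  {within closure Omega, continuous f} /\
  forall x, boundary Omega x -> f x = 0.

(* C([0, T], C_0(Omega)), continuity being for uniform convergence on the closure
   of Omega. *)
Definition continuous_in_C0 {R : realType} (Omega : set (R * R)) (T : R)
    (u : R -> R * R -> R) : Prop :=
  (forall t, 0 <= t <= T -> C0 Omega (u t)) /\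
  {within `[0, T], continuous (u : R -> {uniform` closure Omega -> R})}.

Definition nonlinearity {R : realType} (u_minus u_m u_plus : R) (v : R) : R :=
  v * (v + u_minus - u_m) * (v + u_minus - u_plus).

(* Duhamel formula u(t) = Q(t) u0 - \int_0^t Q(t - s) N(u(s)) ds; [q] represents
   Q(t) u0, [F s] represents Q(t - s) N(u(s)) and [I] the integral. *)
Definition mild_solution {R : realType} (Omega : set (R * R))
    (lam : nat -> R) (phi : nat -> R * R -> R) (alpha eps T : R)
    (N : R -> R) (u0 : R * R -> R) (u : R -> R * R -> R) : Prop :=
  continuous_in_C0 Omega T u /\
  forall t, 0 <= t <= T ->
    exists (q : R * R -> R) (F : R -> R * R -> R) (I : R * R -> R),
      [/\ is_semigroup Omega lam phi alpha eps t u0 q,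
          forall s, 0 <= s <= t ->
            is_semigroup Omega lam phi alpha eps (t - s) (N \o u s) (F s),
          is_L2_integral Omega F 0 t I
        & {ae mu2 R, forall x, Omega x -> u t x = q x - I x}].

(* Main.v *)
Require Import Defs.
From mathcomp Require Import all_boot all_order all_algebra.
From mathcomp Require Import all_classical all_reals all_analysis.
From mathcomp Require Import measurable_realfun.
From mathcomp Require Import ring lra.
Set Implicit Arguments.
Unset Strict Implicit.
Unset Printing Implicit Defensive.
Import Order.TTheory GRing.Theory Num.Theory.
Import numFieldNormedType.Exports.
Local Open Scope classical_set_scope.
Local Open Scope ring_scope.

(** Let M = u_plus - u_minus, let K be the closed convex set of functions of
    L^2(Omega) with values in [0, M], and let p(v) be v minus its projection on
    K.  Pointwise, p(v) is the excess of v over the interval [0, M], counted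
    negatively below 0.  The solution stays in K because its distance to K does
    not increase: with A the Dirichlet Laplacian -Delta,

      d/dt (|p(u)|^2 / 2) = <u', p(u)>
                          = - eps^2 <A^alpha u, p(u)> - <N(u), p(u)>,

    and neither term on the right is positive.

    For the reaction term this is a sign condition on the cubic: outside [0, M],
    N(v) has the sign of the excess of v ([nonlinearity_excess_ge0]).

    For the diffusion term, start with A itself.  Green's formula gives
    <A w, p(w)> = \int p'(w) |grad w|^2 >= 0; this becomes a proof in H^1_0 after
    replacing w by test functions and the excess by a smooth increasing function
    ([dirichlet_excess_ge0]).  The inequality <A w, p(w)> >= 0 passes to
    A / (s + A), for s > 0, by the geometry of projections alone
    ([residual_resolvent_ge0]).  It then passes to A^alpha, as l^alpha is an
    integral of the functions l / (s + l) with positive weights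
    ([powR_stieltjes_comb_ge0], [residual_powR_ge0]).

    Since u(t) need not lie in the domain of A^alpha, the computation is carried
    out on finite sums of eigenfunctions.  The Duhamel formula says that the
    coefficients of u solve c_k' = - eps^2 lam_k^alpha c_k - <N(u), phi_k>
    ([mild_solution_coef]).  All inequalities above hold for finite sums, except
    that N(u) is replaced by its projection on the span of finitely many
    eigenfunctions; the error tends to 0 uniformly in time
    ([residual_nonincreasing]).

    Hence u(t) takes values in [0, M] almost everywhere on Omega, so everywhere
    on Omega by continuity ([nrm_excess_eq0]), and u(t) = 0 on the boundary. *)

(** * Antiderivatives and fractional powers *)

Lemma continuous_antiderivative_itv (R : realType) (g : R -> R) (r : R) :
  continuous g -> exists G : R -> R,
    forall x, - r < x < r -> is_derive x 1 G (g x).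
Proof.
move=> cg; exists (fun x => (\int[@lebesgue_measure R]_(t in `[- r - 1, x]) g t)%R).
move=> x /andP[rx xr].
have [//||//||dG GE] := @continuous_FTC1_closed R g (- r - 1) x r.
- apply: continuous_compact_integrable; first exact: segment_compact.
  exact: continuous_subspaceT.
- by rewrite ltrBlDr (lt_trans rx)// ltrDl.
- exact: cg.
by apply: (DeriveDef dG); rewrite -derive1E; exact: GE.
Qed.

Lemma is_derive_itv_eq (R : realType) (F G g : R -> R) (r : R) :
  (forall x, - r < x < r -> is_derive x 1 F (g x)) ->
  (forall x, - r < x < r -> is_derive x 1 G (g x)) ->
  forall x, - r < x < r -> F x - F 0 = G x - G 0.
Proof.
move=> dF dG x /andP[rx xr].
have r0 : 0 < r by rewrite -(pmulr_rgt0 _ (@ltr0n R 2)); nra.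
pose D y := F y - G y.
have dD y : - r < y < r -> is_derive y 1 D 0.
  move=> yr; have dFy := dF _ yr; have dGy := dG _ yr.
  rewrite -(subrr (g y)); exact: is_deriveB.
have Dcst a b : - r < a -> a <= b -> b < r -> D b = D a.
  move=> ra ab br; apply/eqP; rewrite -subr_eq0; apply/eqP.
  have [y|y|c _ ->] := @MVT_segment _ D (cst 0) a b ab.
  - rewrite in_itv/= => /andP[ay yb]; apply: dD.
    by rewrite (lt_trans ra ay) (lt_trans yb br).
  - apply: continuous_in_subspaceT => z; rewrite inE/= in_itv/= => /andP[az zb].
    apply: differentiable_continuous; apply/derivable1_diffP.
    suff: is_derive z 1 D 0 by case.
    by apply: dD; rewrite (lt_le_trans ra az) (le_lt_trans zb br).
  - by rewrite /= mul0r.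
suff : D x = D 0 by rewrite /D; lra.
have [x0|x0] := leP 0 x; first by rewrite (Dcst 0 x)// oppr_lt0.
by rewrite [RHS](Dcst x 0)// ltW.
Qed.

(** Antiderivatives on larger and larger intervals, normalized at 0, agree on
    their common domain, hence glue. *)
Lemma continuous_antiderivative (R : realType) (g : R -> R) :
  continuous g -> exists G : R -> R, forall x : R, is_derive x 1 G (g x).
Proof.
move=> cg.
have [G dG] : {G : nat -> R -> R & forall n (x : R), - n%:R < x < n%:R ->
    is_derive x 1 (G n) (g x)}.
  apply: (@choice _ _ (fun n H => forall x : R, - n%:R < x < n%:R ->
    is_derive x 1 H (g x))) => n.
  exact: continuous_antiderivative_itv.
pose n (x : R) := (Num.truncn `|x|).+1.
have nP (x : R) : `|x| < (n x)%:R by exact: truncnS_gt.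
exists (fun x => G (n x) x - G (n x) 0) => x.
apply: (@near_eq_is_derive _ _ _ (fun y => G (n x) y - G (n x) 0)).
  near=> y.
  have yx : `|y| < (n x)%:R.
    near: y; apply: (@cvgr_lt _ _ _ _ (@Num.norm _ R) `|x|) => //.
    exact: (@norm_continuous _ R x).
  have dGW m k : (m <= k)%N -> forall z : R, - m%:R < z < m%:R ->
      is_derive z 1 (G k) (g z).
    move=> mk z /andP[z1 z2]; apply: dG.
    by rewrite (le_lt_trans _ z1) ?(lt_le_trans z2)// ?lerN2 ler_nat.
  have [h|/ltnW h] := leqP (n x) (n y).
    apply: (@is_derive_itv_eq _ _ _ g (n x)%:R); [exact: dG|exact: dGW|].
    by rewrite -ltr_norml.
  apply: (@is_derive_itv_eq _ _ _ g (n y)%:R); [exact: dGW|exact: dG|].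
  by rewrite -ltr_norml.
have dGx : is_derive x 1 (G (n x)) (g x) by apply: dG; rewrite -ltr_norml.
rewrite -[g x]subr0.
exact: (@is_deriveB _ _ _ (G (n x)) (cst (G (n x) 0)) x 1 (g x) 0).
Unshelve. all: by end_near. Qed.

Lemma is_derive_mull (R : numFieldType) (V : normedModType R) (c : R) (f : V -> R)
    (x v : V) (df : R) :
  is_derive x v f df -> is_derive x v (fun t => c * f t) (c * df).
Proof. by move=> dF; exact: (@is_deriveZ _ _ _ f c x v df). Qed.

Lemma increment_le (R : realType) (F E f e : R -> R) (x y : R) :
  (forall z : R, is_derive z 1 F (f z)) -> (forall z : R, is_derive z 1 E (e z)) ->
  x <= y -> (forall z, x <= z <= y -> f z <= e z) -> F y - F x <= E y - E x.
Proof.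
move=> dF dE xy fe.
have dD (z : R) : is_derive z 1 (fun t => E t - F t) (e z - f z).
  exact: is_deriveB.
suff : E x - F x <= E y - F y by lra.
have [|z] := @MVT_segment _ (fun t => E t - F t) (fun z => e z - f z) x y xy.
  by apply: derivable_within_continuous => z _; case: (dD z).
rewrite in_itv/= => /fe; nra.
Qed.

(** The substitution s = exp y turns the integral representation
    [\int_0^oo s^(a - 1) l / (s + l) ds = c l^a] into a convolution in [y]:
    up to the factor [l^a], the integrand for [l] is the translate by [ln l] of
    the integrand for 1.  An antiderivative G of the latter is increasing and
    bounded, and the combination below of its translates is nondecreasing; its
    total increment is [c * \sum_k b k * l k `^ a]. *)
Lemma powR_stieltjes_comb_ge0 (R : realType) (a : R) (n : nat) (b l : nat -> R) :
  0 < a < 1 -> (forall k, 0 <= l k) ->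
  (forall s, 0 < s -> 0 <= \sum_(k < n) b k * (l k / (s + l k))) ->
  0 <= \sum_(k < n) b k * l k `^ a.
Proof.
move=> /andP[a0 a1] l0 H.
pose g (y : R) := expR (a * y) / (expR y + 1).
have e1 (y : R) : expR y + 1 != 0 by rewrite gt_eqF// addr_gt0// expR_gt0.
have cg : continuous g.
  move=> y; apply: cvgM.
    apply: continuous_comp; last exact: continuous_expR.
    by apply: cvgM; [exact: cvg_cst|exact: cvg_id].
  apply: cvgV => //; apply: cvgD; [exact: continuous_expR|exact: cvg_cst].
have g0 y : 0 < g y by rewrite divr_gt0// ?addr_gt0// expR_gt0.
have [G dG] := continuous_antiderivative cg.
have Gmono x y : x <= y -> G x <= G y.
  move=> xy; have := @increment_le _ (cst 0) G (cst 0) g x y _ _ xy.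
  rewrite /= subrr subr_ge0; apply => // z _; exact: ltW.
have dexp (c : R) : c != 0 -> forall y : R,
    is_derive y 1 (fun t : R => c^-1 * expR (c * t)) (expR (c * y)).
  move=> c0 y.
  have d1 : is_derive y 1 (fun t : R => c * t) c.
    by rewrite -[X in is_derive _ _ _ X]mulr1; apply: is_derive_mull.
  have d2 := @is_derive1_comp R expR (fun t => c * t) y (expR (c * y)) c
    (is_derive_expR _) d1.
  rewrite -[X in is_derive _ _ _ X](mulKf c0).
  rewrite [c * expR _]mulrC; exact: (is_derive_mull _ d2).
have Gub x y : x <= y -> G y - G x <= (1 - a)^-1 * expR (- (1 - a) * x).
  move=> xy; have b0 : - (1 - a) != 0 by rewrite oppr_eq0 subr_eq0 gt_eqF.
  have := @increment_le _ _ _ _ _ x y dG (dexp _ b0) xy.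
  rewrite invrN !mulNr opprK => h; apply: (le_trans (h _)).
    move=> z _; rewrite ler_pdivrMr ?addr_gt0 ?expR_gt0// mulrDr mulr1 -expRD.
    rewrite (_ : - (1 - a) * z + z = a * z); last by ring.
    by rewrite lerDl expR_ge0.
  have : 0 <= (1 - a)^-1 * expR (- ((1 - a) * y)).
    by rewrite mulr_ge0 ?expR_ge0// invr_ge0 subr_ge0 ltW.
  lra.
have Glb x y : x <= y -> G y - G x <= a^-1 * expR (a * y).
  move=> xy; have := @increment_le _ _ _ _ _ x y dG (dexp _ (lt0r_neq0 a0)) xy.
  move=> h; apply: (le_trans (h _)).
    move=> z _; rewrite ler_pdivrMr ?addr_gt0 ?expR_gt0// mulrDr mulr1.
    by rewrite lerDr mulr_ge0 ?expR_ge0.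
  have : 0 <= a^-1 * expR (a * x) by rewrite mulr_ge0 ?expR_ge0// invr_ge0 ltW.
  lra.
have [Lp GLp] : exists L : R, G y @[y --> +oo%R] --> L.
  exists (sup (range G)); apply: nondecreasing_cvgr => //.
  exists (G 0 + (1 - a)^-1 * expR (- (1 - a) * 0)) => _ [y _ <-].
  have [y0|/ltW y0] := leP 0 y; first by rewrite -lerBlDl Gub.
  rewrite (le_trans (Gmono _ _ y0))// lerDl mulr_ge0 ?expR_ge0//.
  by rewrite invr_ge0 subr_ge0 ltW.
have [Lm GLm] : exists L : R, - G (- y) @[y --> +oo%R] --> L.
  exists (sup (range (fun y => - G (- y)))); apply: nondecreasing_cvgr.
    by move=> x y xy; rewrite lerN2 Gmono// lerN2.
  exists (a^-1 * expR (a * 0) - G 0) => _ [y _ <-].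
  have [y0|/ltW y0] := leP 0 y.
    by rewrite lerBrDr addrC Glb// oppr_le0.
  apply: (@le_trans _ _ (- G 0)); first by rewrite lerN2 Gmono// oppr_ge0.
  by rewrite lerDr mulr_ge0 ?expR_ge0// invr_ge0 ltW.
have c0 : 0 < Lp + Lm.
  apply: (@lt_le_trans _ _ (G 1 - G (- 1))).
    have [||z _] := @MVT _ G g (- 1) 1 _ (fun z _ => dG z); first by lra.
      by apply: derivable_within_continuous => z _; case: (dG z).
    by move: (g0 z) => + ->; nra.
  apply: (cvgr_to_ge (cvgD GLp GLm)); near=> y.
  have y1 : 1 <= y by near: y; exact: nbhs_pinfty_ge.
  by rewrite /= lerD ?lerN2 ?Gmono// lerN2.
(* S' (y) = expR (a * y) * \sum_k b k * (l k / (expR y + l k)) is nonnegative;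
   where l k = 0, ln (l k) is a default value that the factor c k cancels. *)
pose c k := b k * l k `^ a.
pose S y := \sum_(k < n) c k * G (y - ln (l k)).
have cg_ y k : c k * g (y - ln (l k)) =
    expR (a * y) * (b k * (l k / (expR y + l k))).
  have [lk0|lk0] := eqVneq (l k) 0.
    by rewrite /c lk0 powR0 ?gt_eqF// !(mulr0, mul0r).
  have lkp : 0 < l k by rewrite lt_neqAle eq_sym lk0 l0.
  rewrite /c /g /powR (negPf lk0) mulrBr !expRD !expRN lnK ?posrE//.
  have := expR_gt0 y; have := expR_gt0 (a * ln (l k)) => p1 p2.
  by field; rewrite !gt_eqF// ?addr_gt0.
have dS (y : R) : is_derive y 1 S (\sum_(k < n) c k * g (y - ln (l k))).
  rewrite (_ : S = \sum_(k < n) (fun y => c k * G (y - ln (l k)))); last first.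
    by apply/funext => z; rewrite fct_sumE.
  apply: is_derive_sum => k; apply: is_derive_mull.
  rewrite -[g _]mulr1.
  apply: (@is_derive1_comp _ G (fun y => y - ln (l k))).
  rewrite -[X in is_derive _ _ _ X]subr0; apply: is_deriveB.
have Smono y : 0 <= y -> S (- y) <= S y.
  move=> y0; have yy : - y <= y by rewrite ge0_cp.
  have := @increment_le _ (cst 0) S (cst 0) _ _ _ _ dS yy.
  rewrite /= subrr subr_ge0; apply => // z _.
  under eq_bigr do rewrite cg_; rewrite -mulr_sumr.
  by rewrite mulr_ge0 ?expR_ge0 ?H ?expR_gt0.
suff : 0 <= (Lp + Lm) * \sum_(k < n) c k by rewrite pmulr_rge0.
rewrite mulr_sumr.
have cvS : \sum_(k < n) c k * (G (y - ln (l k)) - G (- (y + ln (l k))))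
    @[y --> +oo%R] --> \sum_(k < n) (Lp + Lm) * c k.
  apply: cvg_big => //; [exact: add_continuous|move=> k _].
  rewrite mulrC; apply: cvgMl_tmp; apply: cvgD.
    exact: (cvg_comp (fun y => y - ln (l k)) G (cvg_addrr _) GLp).
  exact: (cvg_comp (fun y => y + ln (l k)) (fun y => - G (- y)) (cvg_addrr _)
    GLm).
apply: (cvgr_to_ge cvS); near=> y.
have /Smono : 0 <= y by near: y; exact: nbhs_pinfty_ge.
rewrite -subr_ge0 -sumrB; congr (_ <= _); apply: eq_bigr => k _.
by rewrite mulrBr opprD.
Unshelve. all: by end_near. Qed.

(** * Semi-inner products, projections and energy *)

(** Differentiates an energy F of which only a first-order expansion is known:
    L is the expansion and M a quadratic bound on its remainder. *)
Lemma is_derive_tangent (R : realType) (F L M : R -> R) (t l : R) :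
  is_derive t 1 L l -> is_derive t 1 M 0 -> M t = 0 ->
  (forall s, `|F s - F t - (L s - L t)| <= M s) -> is_derive t 1 F l.
Proof.
move=> dL dM Mt0 FLM.
have dD : is_derive t 1 (fun s => F s - L s) 0.
  have cvD : (fun h => h^-1 *: ((F (h *: 1 + t) - L (h *: 1 + t)) - (F t - L t)))
      @ 0^' --> (0 : R).
    have cM : `|h^-1 *: (M (h *: 1 + t) - M t)| @[h --> 0^'] --> (0 : R).
      rewrite -[X in _ --> X](@normr0 _ R) -[X in `|X|](@derive_val _ _ _ _ _ M _ dM).
      by apply: cvg_norm; case: dM.
    apply/norm_cvg0P.
    refine (@squeeze_cvgr _ _ _ _ (cst 0) _ _ _ 0 (cvg_cst _) cM).
    near=> h; rewrite normr_ge0/= Mt0 subr0 !normrZ ler_wpM2l//.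
    apply: le_trans (ler_norm _); apply: le_trans (FLM (h *: 1 + t)).
    by rewrite [X in `|X| <= _](_ : _ = F (h *: 1 + t) - F t - (L (h *: 1 + t) - L t))//; ring.
  apply: DeriveDef; first by apply/cvg_ex; exists 0.
  exact: cvg_lim cvD.
rewrite -[l]addr0 addrC (_ : F = (fun s => F s - L s) \+ L).
  exact: is_deriveD.
by apply/funext => s /=; rewrite subrK.
Unshelve. all: by end_near. Qed.

Section SemiInner.
Context (R : realType) (V : lmodType R) (ip : V -> V -> R).

(** Vectors of norm 0 need not vanish: in the application they are the functions
    that vanish almost everywhere on a domain. *)
Definition semi_inner : Prop :=
  [/\ forall u v, ip u v = ip v u,
      forall u v w, ip (u + v) w = ip u w + ip v w,
      forall a u v, ip (a *: u) v = a * ip u v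
    & forall u, 0 <= ip u u].

Definition nrm (u : V) : R := Num.sqrt (ip u u).

Hypothesis hip : semi_inner.

Lemma ipC u v : ip u v = ip v u. Proof. by case: hip. Qed.
Lemma ipDl u v w : ip (u + v) w = ip u w + ip v w. Proof. by case: hip. Qed.
Lemma ipZl a u v : ip (a *: u) v = a * ip u v. Proof. by case: hip. Qed.
Lemma ip_ge0 u : 0 <= ip u u. Proof. by case: hip. Qed.

Lemma ip0l v : ip 0 v = 0. Proof. by rewrite -(scale0r 0) ipZl mul0r. Qed.
Lemma ipNl u v : ip (- u) v = - ip u v.
Proof. by rewrite -scaleN1r ipZl mulN1r. Qed.
Lemma ipBl u v w : ip (u - v) w = ip u w - ip v w.
Proof. by rewrite ipDl ipNl. Qed.
Lemma ipDr u v w : ip u (v + w) = ip u v + ip u w.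
Proof. by rewrite ipC ipDl !(ipC u). Qed.
Lemma ipNr u v : ip u (- v) = - ip u v.
Proof. by rewrite ipC ipNl ipC. Qed.
Lemma ipBr u v w : ip u (v - w) = ip u v - ip u w.
Proof. by rewrite ipDr ipNr. Qed.
Lemma ipZr a u v : ip u (a *: v) = a * ip u v.
Proof. by rewrite ipC ipZl ipC. Qed.

Lemma ip_suml n (f : 'I_n -> V) v :
  ip (\sum_(k < n) f k) v = \sum_(k < n) ip (f k) v.
Proof.
by apply: (big_morph (ip^~ v)) => [x y|]; [exact: ipDl|exact: ip0l].
Qed.

Lemma nrm_ge0 u : 0 <= nrm u. Proof. exact: sqrtr_ge0. Qed.
Lemma sqr_nrm u : nrm u ^+ 2 = ip u u. Proof. by rewrite sqr_sqrtr// ip_ge0. Qed.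

Lemma nrmN u : nrm (- u) = nrm u.
Proof. by rewrite /nrm ipNl ipNr opprK. Qed.

Lemma nrmB u v : nrm (u - v) = nrm (v - u).
Proof. by rewrite -nrmN opprB. Qed.

Lemma ip_le_nrm u v : `|ip u v| <= nrm u * nrm v.
Proof.
rewrite -ler_sqr ?nnegrE ?mulr_ge0 ?nrm_ge0// exprMn !sqr_nrm real_normK ?num_real//.
have h (a b : R) : 0 <= a ^+ 2 * ip u u + 2 * (a * b) * ip u v + b ^+ 2 * ip v v.
  have := ip_ge0 (a *: u + b *: v).
  by rewrite ipDl !ipDr !ipZl !ipZr (ipC v u); congr (_ <= _); ring.
(* The quadratic form h is tested at (- ip u v, ip u u), where it is minimal for
   fixed b; when ip u u = 0 it is affine in a, hence unbounded unless ip u v = 0. *)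
have [uu0|uu0] := eqVneq (ip u u) 0.
  have [->|uv0] := eqVneq (ip u v) 0; first by rewrite expr0n/= uu0 mul0r.
  have := h (- (ip v v + 1) / ip u v) 1; have := ip_ge0 v.
  by rewrite uu0 mulr1 -mulrA divfK// mulr0; lra.
have := h (- ip u v) (ip u u); have : 0 < ip u u by rewrite lt_def uu0 ip_ge0.
move: (ip u u) (ip v v) (ip u v) => x y z; nra.
Qed.

Lemma ler_nrmD u v : nrm (u + v) <= nrm u + nrm v.
Proof.
rewrite -ler_sqr ?nnegrE ?addr_ge0 ?nrm_ge0// sqrrD !sqr_nrm ipDl !ipDr (ipC v u).
have := le_trans (ler_norm _) (ip_le_nrm u v); rewrite -mulr_natl; lra.
Qed.

Lemma nrm_triangle v u w : nrm (u - w) <= nrm (u - v) + nrm (v - w).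
Proof.
by rewrite (le_trans _ (ler_nrmD _ _))// addrA subrK.
Qed.

Lemma ler_nrm_dist u v : `|nrm u - nrm v| <= nrm (u - v).
Proof.
have := ler_nrmD (u - v) v; have := ler_nrmD (v - u) u.
by rewrite !subrK (nrmB v u) ler_norml; lra.
Qed.

Lemma nrmZ (a : R) u : nrm (a *: u) = `|a| * nrm u.
Proof.
by rewrite /nrm ipZl ipZr mulrA -expr2 sqrtrM ?sqr_ge0// sqrtr_sqr.
Qed.

Lemma ler_nrm_sum n (u : 'I_n -> V) :
  nrm (\sum_(k < n) u k) <= \sum_(k < n) nrm (u k).
Proof.
elim: n u => [|n IH] u; first by rewrite !big_ord0 /nrm ip0l sqrtr0.
rewrite !big_ord_recr/=; apply: (le_trans (ler_nrmD _ _)).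
by rewrite lerD2r.
Qed.

Lemma nrm_sum_cvg n (a : 'I_n -> R) (u_ : 'I_n -> nat -> V) (u : 'I_n -> V) :
  (forall k, nrm (u_ k m - u k) @[m --> \oo] --> 0) ->
  nrm (\sum_(k < n) a k *: u_ k m - \sum_(k < n) a k *: u k) @[m --> \oo] --> 0.
Proof.
move=> cu; have cs : \sum_(k < n) `|a k| * nrm (u_ k m - u k) @[m --> \oo] --> 0.
  rewrite [X in _ --> X](_ : 0 = \sum_(k < n) `|a k| * 0); last first.
    by rewrite big1// => k _; rewrite mulr0.
  by apply: cvg_big => //; [exact: add_continuous|move=> k _; exact: cvgMl_tmp].
refine (@squeeze_cvgr _ _ _ _ (cst 0) _ _ _ 0 (cvg_cst _) cs).
apply: nearW => m; rewrite nrm_ge0/= -sumrB; apply: (le_trans (ler_nrm_sum _)).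
by apply: ler_sum => k _; rewrite -scalerBr nrmZ.
Qed.

Lemma nrm_cvg_eq (u v : nat -> V) (w : V) : (forall m, nrm (u m - v m) = 0) ->
  nrm (v m - w) @[m --> \oo] --> 0 -> nrm (u m - w) @[m --> \oo] --> 0.
Proof.
move=> uv cv; refine (@squeeze_cvgr _ _ _ _ (cst 0) _ _ _ 0 (cvg_cst _) cv).
apply: nearW => m; rewrite nrm_ge0/=; apply: (le_trans (nrm_triangle (v m) _ _)).
by rewrite uv add0r.
Qed.

(** ** Residuals of projections onto convex sets *)

(** The obtuse-angle inequality characterizes p = id - P with P the metric
    projection onto a convex set: [v - P v] makes an obtuse angle with every
    vector from [P v] to a point of the set. *)
Definition projection_residual (p : V -> V) : Prop :=
  forall v w, 0 <= ip ((v - p v) - (w - p w)) (p v).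

Section Residual.
Variable p : V -> V.
Hypothesis hp : projection_residual p.

Lemma residual_ip v w : ip (p v) (p v) - ip (p w) (p v) <= ip (v - w) (p v).
Proof. by have := hp v w; rewrite !ipBl; lra. Qed.

(** p is firmly nonexpansive: the sum of the obtuse-angle inequalities at (v, w)
    and (w, v) bounds [nrm (p v - p w) ^+ 2] by [ip (v - w) (p v - p w)]. *)
Lemma nrm_residualB v w : nrm (p v - p w) <= nrm (v - w).
Proof.
have h : ip (p v - p w) (p v - p w) <= ip (v - w) (p v - p w).
  have := residual_ip v w; have := residual_ip w v.
  by rewrite !(ipBl, ipBr); have := ipC (p v) (p w); lra.
have := le_trans h (le_trans (ler_norm _) (ip_le_nrm _ _)).
rewrite -sqr_nrm; move: (nrm_ge0 (p v - p w)) (nrm_ge0 (v - w)).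
by move: (nrm (p v - p w)) (nrm (v - w)) => x y; nra.
Qed.

(** Half the squared distance to the convex set is a convex function with
    gradient p, and p is 1-Lipschitz.  The obtuse-angle inequality at (v, w)
    bounds the remainder below, and the one at (w, v) bounds it above. *)
Lemma residual_taylor v w :
  `|ip (p w) (p w) / 2 - ip (p v) (p v) / 2 - ip (w - v) (p v)|
    <= ip (w - v) (w - v) / 2.
Proof.
have := residual_ip v w; have := residual_ip w v.
have := ip_ge0 (p w - p v); have := ip_ge0 ((w - v) - (p w - p v)).
rewrite ler_norml !(ipBl, ipBr).
have := ipC v w; have := ipC (p v) (p w); have := ipC (p v) w.
have := ipC (p w) v; have := ipC (p v) v; have := ipC (p w) w.
lra.
Qed.

(** ** Bernstein functions of a diagonal operator *)

(** If the form of a nonnegative diagonal operator A is nonnegative on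
    [(w, p w)], so is that of [A / (s + A)].  Indeed let [v = s / (s + A) w], so
    that [w - v = A v / s]. The hypothesis at v says [0 <= ip (w - v) (p v)],
    hence [nrm (p v) <= nrm (p w)]: v is no further from the convex set than w.
    This in turn gives [0 <= ip (w - v) (p w)], and [w - v = A / (s + A) w]. *)
Lemma residual_resolvent_ge0 (phi : nat -> V) (l : nat -> R) n :
  (forall k, 0 <= l k) ->
  (forall a : nat -> R,
     0 <= ip (\sum_(k < n) (l k * a k) *: phi k) (p (\sum_(k < n) a k *: phi k))) ->
  forall (s : R) (a : nat -> R), 0 < s ->
    0 <= ip (\sum_(k < n) (l k / (s + l k) * a k) *: phi k)
            (p (\sum_(k < n) a k *: phi k)).
Proof.
move=> l0 H s a s0.
have sl k : s + l k != 0 by rewrite gt_eqF// ltr_pwDl.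
pose b k := s / (s + l k) * a k.
set w := \sum_(k < n) a k *: phi k; pose v := \sum_(k < n) b k *: phi k.
have wvE : \sum_(k < n) (l k / (s + l k) * a k) *: phi k = w - v.
  rewrite -sumrB; apply: eq_bigr => k _; rewrite -scalerBl; congr (_ *: _).
  by rewrite /b; have := sl k => ?; field.
have lbE : \sum_(k < n) (l k * b k) *: phi k = s *: (w - v).
  rewrite -wvE scaler_sumr; apply: eq_bigr => k _; rewrite scalerA.
  by congr (_ *: _); rewrite /b; have := sl k => ?; field.
have := H b; rewrite lbE ipZl pmulr_rge0// -/v => wv.
have vw : ip (p v) (p v) <= ip (p w) (p v).
  by have := residual_ip v w; move: wv; rewrite !ipBl; lra.
have pvw : nrm (p v) <= nrm (p w).
  have := le_trans vw (le_trans (ler_norm _) (ip_le_nrm _ _)).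
  rewrite -sqr_nrm; move: (nrm_ge0 (p v)) (nrm_ge0 (p w)).
  by move: (nrm (p v)) (nrm (p w)) => x y; nra.
rewrite wvE.
have := residual_ip w v; have := le_trans (ler_norm _) (ip_le_nrm (p v) (p w)).
rewrite -sqr_nrm; move: (nrm_ge0 (p v)) (nrm_ge0 (p w)) pvw.
by move: (nrm (p v)) (nrm (p w)) => x y; nra.
Qed.

(** [l `^ alpha] is a limit of positive combinations of the functions
    [l / (s + l)], so the inequality for [A / (s + A)] integrates to one for the
    powers of A. *)
Lemma residual_powR_ge0 (phi : nat -> V) (l : nat -> R) (alpha : R) n :
  0 < alpha < 1 -> (forall k, 0 <= l k) ->
  (forall a : nat -> R,
     0 <= ip (\sum_(k < n) (l k * a k) *: phi k) (p (\sum_(k < n) a k *: phi k))) ->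
  forall a : nat -> R,
    0 <= ip (\sum_(k < n) (l k `^ alpha * a k) *: phi k)
            (p (\sum_(k < n) a k *: phi k)).
Proof.
move=> halpha l0 H a; set w := \sum_(k < n) a k *: phi k.
have ipE (c : nat -> R) : ip (\sum_(k < n) (c k * a k) *: phi k) (p w) =
    \sum_(k < n) (a k * ip (phi k) (p w)) * c k.
  by rewrite ip_suml; apply: eq_bigr => k _; rewrite ipZl; ring.
rewrite (ipE (fun k => l k `^ alpha)).
apply: (@powR_stieltjes_comb_ge0 _ _ _ (fun k => a k * ip (phi k) (p w))) => // s s0.
by rewrite -(ipE (fun k => l k / (s + l k))); exact: residual_resolvent_ge0.
Qed.

End Residual.

(** ** Orthonormal families *)

Section Orthonormal.
Variable phi : nat -> V.
Hypothesis phi_orthonormal : forall j k, ip (phi j) (phi k) = (j == k)%:R.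

Definition partial_sum n (v : V) : V := \sum_(k < n) ip v (phi k) *: phi k.

Lemma partial_sumB n u v :
  partial_sum n (u - v) = partial_sum n u - partial_sum n v.
Proof. by rewrite -sumrB; apply: eq_bigr => k _; rewrite ipBl scalerBl. Qed.

Lemma ip_sum_phi n (a : 'I_n -> R) (j : 'I_n) :
  ip (\sum_(k < n) a k *: phi k) (phi j) = a j.
Proof.
rewrite ip_suml (bigD1 j)//= ipZl phi_orthonormal eqxx mulr1 big1 ?addr0// => k kj.
by rewrite ipZl phi_orthonormal (_ : (k == j :> nat) = false) ?mulr0 //; exact/negbTE.
Qed.

Lemma ip_partial_sum n u v : ip (partial_sum n u) v =
  \sum_(k < n) ip u (phi k) * ip v (phi k).
Proof.
by rewrite ip_suml; apply: eq_bigr => k _; rewrite ipZl (ipC (phi k)).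
Qed.

(** Pythagoras: the remainder is orthogonal to the partial sum. *)
Lemma nrm_partial_sum_residual n v : nrm (v - partial_sum n v) <= nrm v.
Proof.
rewrite -ler_sqr ?nnegrE ?nrm_ge0// !sqr_nrm ipBl !ipBr.
rewrite (ipC v) !ip_partial_sum.
under [X in _ - (_ - X)]eq_bigr do rewrite ip_sum_phi.
by rewrite subrr subr0 lerBlDr lerDl sumr_ge0// => k _; rewrite -expr2 sqr_ge0.
Qed.

Lemma nrm_partial_sum_residualB n u v :
  nrm (v - partial_sum n v) <= nrm (u - partial_sum n u) + nrm (v - u).
Proof.
have := nrm_partial_sum_residual n (v - u); rewrite partial_sumB.
rewrite [v - u - _](_ : _ = v - partial_sum n v - (u - partial_sum n u)).
  have := ler_nrmD (u - partial_sum n u) (v - partial_sum n v - (u - partial_sum n u)).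
  by rewrite addrC subrK; lra.
by rewrite !opprD !opprK addrACA.
Qed.

Hypothesis phi_complete : forall v, nrm (v - partial_sum n v) @[n --> \oo] --> 0.

(** An element is determined, up to norm 0, by its coefficients. *)
Lemma nrm_eq0_coef v : (forall k, ip v (phi k) = 0) -> nrm v = 0.
Proof.
move=> v0; have S0 n : partial_sum n v = 0.
  by apply: big1 => k _; rewrite v0 scale0r.
have cv := phi_complete v.
have cv' : nrm (v - partial_sum n v) @[n --> \oo] --> nrm v.
  have -> : (fun n => nrm (v - partial_sum n v)) = cst (nrm v).
    by apply/funext => n; rewrite S0 subr0.
  exact: cvg_cst.
exact: (cvg_unique (@Rhausdorff R) cv' cv).
Qed.

(** Expansions converge uniformly along a continuous path on a compact interval,
    since [v - partial_sum n v] is a contraction in v. *)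
Lemma partial_sum_cvg_uniform (U : R -> V) (a b e : R) :
  (forall t, nrm (U s - U t) @[s --> t] --> 0) -> 0 < e ->
  \forall n \near \oo, forall t, a <= t <= b ->
    nrm (U t - partial_sum n (U t)) < e.
Proof.
move=> cU e0.
have /compact_near_coveringP := @segment_compact R a b.
move=> /(_ nat \oo (fun n t => nrm (U t - partial_sum n (U t)) < e) _) H.
near=> n => t abt.
suff : `[a, b]%classic `<=` (fun t => nrm (U t - partial_sum n (U t)) < e).
  by apply; rewrite /= in_itv.
near: n; apply: H => x _.
have e2 : 0 < e / 2 by rewrite divr_gt0.
near=> y i => /=.
apply: (le_lt_trans (nrm_partial_sum_residualB i (U x) (U y))).
rewrite [e]splitr ltrD//.
  near: i; exact: (cvgr_lt 0 (phi_complete (U x))).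
near: y; exact: (cvgr_lt 0 (cU x)).
Unshelve. all: by end_near. Qed.

Lemma path_bounded (U : R -> V) (a b : R) :
  (forall t, nrm (U s - U t) @[s --> t] --> 0) ->
  exists B, forall t, a <= t <= b -> nrm (U t) <= B.
Proof.
move=> cU.
have /compact_near_coveringP := @segment_compact R a b.
move=> /(_ R +oo%R (fun B t => nrm (U t) <= B) _) H.
suff [B HB] : \forall B \near +oo, `[a, b]%classic `<=` (fun t => nrm (U t) <= B).
  exists (B + 1) => t abt; apply: (proj2 HB) => /=; first by rewrite ltrDl.
  by rewrite in_itv.
apply: H => x _; near=> y B => /=.
have := nrm_triangle 0 (U y) (U x).
have h : nrm (U y - U x) < 1.
  by near: y; exact: (cvgr_lt 0 (cU x)).
have hB : nrm (U x) + 1 <= B by near: B; apply: nbhs_pinfty_ge; rewrite num_real.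
have := ler_nrmD (U y - U x) (U x); rewrite subrK; lra.
Unshelve. all: by end_near. Qed.

(** The energy estimate.  The Galerkin approximations
    [u n t = \sum_(k < n) c k t *: phi k] have
    [d/dt (nrm (p (u n t)) ^+ 2 / 2) = ip (u n)' (p (u n t))], where the diagonal
    operator contributes with the good sign and the projection of [W t] with an
    error that tends to 0 uniformly in t. *)
Lemma residual_nonincreasing (p : V -> V) (m : nat -> R) (U W : R -> V)
    (c : nat -> R -> R) (T : R) :
  projection_residual p ->
  (forall n (a : nat -> R),
     0 <= ip (\sum_(k < n) (m k * a k) *: phi k) (p (\sum_(k < n) a k *: phi k))) ->
  (forall t, nrm (U s - U t) @[s --> t] --> 0) ->
  (forall t, nrm (W s - W t) @[s --> t] --> 0) ->
  (forall k (t : R), is_derive t 1 (c k) (- (m k * c k t) - ip (W t) (phi k))) ->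
  (forall k t, 0 <= t <= T -> c k t = ip (U t) (phi k)) ->
  (forall t, 0 <= t <= T -> 0 <= ip (W t) (p (U t))) ->
  0 <= T -> nrm (p (U T)) <= nrm (p (U 0)).
Proof.
move=> hp hm cU cW dc cE sW T0.
pose u n t : V := \sum_(k < n) c k t *: phi k.
have uE n t : 0 <= t <= T -> u n t = partial_sum n (U t).
  by move=> tT; apply: eq_bigr => k _; rewrite cE.
pose E n t := ip (p (u n t)) (p (u n t)) / 2.
pose dE n t := \sum_(k < n) (- (m k * c k t) - ip (W t) (phi k)) *
  ip (phi k) (p (u n t)).
have EP n (t : R) : is_derive t 1 (E n) (dE n t).
  pose d k := c k - cst (c k t).
  apply: (@is_derive_tangent _ _
    (\sum_(k < n) (fun s => ip (phi k) (p (u n t)) * c k s))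
    (\sum_(k < n) (fun s => 2^-1 * (d k s * d k s)))).
  - rewrite (_ : dE n t = \sum_(k < n) ip (phi k) (p (u n t)) *
        (- (m k * c k t) - ip (W t) (phi k))); last first.
      by apply: eq_bigr => k _; rewrite mulrC.
    by apply: is_derive_sum => k; exact: is_derive_mull.
  - rewrite [X in is_derive _ _ _ X](_ : 0 = \sum_(k < n) 0 :> R); last first.
      by rewrite big1.
    apply: is_derive_sum => k; rewrite -[X in is_derive _ _ _ X](mulr0 2^-1).
    apply: is_derive_mull; have dk0 : d k t = 0 by rewrite /d !fctE subrr.
    have := @is_deriveM _ _ (d k) (d k) t 1 (- (m k * c k t) - ip (W t) (phi k))
      (- (m k * c k t) - ip (W t) (phi k)).
    rewrite dk0 !scale0r addr0; apply; rewrite -[X in is_derive _ _ _ X]subr0;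
      exact: is_deriveB.
  - by rewrite fct_sumE big1// => k _; rewrite /d !fctE subrr !mulr0.
  - move=> s; have usE : u n s - u n t = \sum_(k < n) d k s *: phi k.
      by rewrite -sumrB; apply: eq_bigr => k _; rewrite -scalerBl.
    have := residual_taylor hp (u n t) (u n s).
    rewrite usE ip_suml [X in `|_ - X| <= _](_ : _ =
      (\sum_(k < n) (fun s => ip (phi k) (p (u n t)) * c k s)) s -
      (\sum_(k < n) (fun s => ip (phi k) (p (u n t)) * c k s)) t); last first.
      rewrite !fct_sumE -sumrB; apply: eq_bigr => k _.
      by rewrite ipZl /d !fctE; ring.
    move=> h; apply: le_trans h _; rewrite ip_suml fct_sumE mulr_suml.
    apply: ler_sum => k _; rewrite ipZl ipC ip_sum_phi; lra.
(* The diagonal term and [ip (W t) (p (U t))] have the good sign.  D bounds the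
   error made by replacing p (U t) with p (u n t) in the latter, then W t with its
   projection. *)
pose D n t := nrm (W t) * nrm (U t - partial_sum n (U t)) +
  nrm (W t - partial_sum n (W t)) * (nrm (p (U t)) + nrm (U t - partial_sum n (U t))).
have dE_le n t : 0 <= t <= T -> dE n t <= D n t.
  move=> tT.
  have -> : dE n t = - ip (\sum_(k < n) (m k * c k t) *: phi k) (p (u n t)) -
      ip (partial_sum n (W t)) (p (u n t)).
    rewrite !ip_suml -opprD -big_split/= -sumrN; apply: eq_bigr => k _.
    by rewrite !ipZl; ring.
  have := hm n (c ^~ t); rewrite -/(u n t) => hmn.
  have h1 := le_trans (ler_norm _) (ip_le_nrm (W t) (p (U t) - p (u n t))).
  have h2 := le_trans (ler_norm _) (ip_le_nrm (W t - partial_sum n (W t)) (p (u n t))).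
  have h3 : nrm (p (U t) - p (u n t)) <= nrm (U t - partial_sum n (U t)).
    by rewrite -uE//; exact: nrm_residualB.
  have h4 : nrm (p (u n t)) <= nrm (p (U t)) + nrm (U t - partial_sum n (U t)).
    by have := ler_nrm_dist (p (U t)) (p (u n t)); rewrite ler_norml; lra.
  have h5 := ler_wpM2l (nrm_ge0 (W t)) h3.
  have h6 := ler_wpM2l (nrm_ge0 (W t - partial_sum n (W t))) h4.
  have := sW t tT; move: h1 h2; rewrite ipBr ipBl /D; lra.
have [B1 HB1] := path_bounded 0 T cW.
have [B2 HB2] := path_bounded 0 T cU.
have [B3 HB3] : exists B, forall t, 0 <= t <= T -> nrm (p (U t)) <= B.
  exists (nrm (p 0) + B2) => t tT.
  have := ler_nrm_dist (p (U t)) (p 0); rewrite ler_norml.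
  have := nrm_residualB hp (U t) 0; rewrite subr0; have := HB2 t tT; lra.
have pu t : nrm (p (partial_sum n (U t))) @[n --> \oo] --> nrm (p (U t)).
  apply/cvgrPdist_lt => e e0; near=> n.
  apply: (le_lt_trans (le_trans (ler_nrm_dist _ _) (nrm_residualB hp _ _))).
  by near: n; exact: (cvgr_lt 0 (phi_complete (U t))).
have T00 : (0 : R) <= 0 <= T by rewrite lexx.
have TT : 0 <= T <= T by rewrite lexx T0.
rewrite -ler_sqr ?nnegrE ?nrm_ge0//.
apply/ler_addgt0Pr => e e0.
have cvE t : nrm (p (partial_sum n (U t))) ^+ 2 @[n --> \oo] --> nrm (p (U t)) ^+ 2.
  exact: (cvgM (pu t) (pu t)).
rewrite -subr_ge0; apply: (cvgr_to_ge (cvgB (cvgD (cvE 0) (cvg_cst e)) (cvE T))).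
(* b bounds the remainders of the expansions of U and W.  It is chosen so that D,
   integrated over [0, T], is at most e / 2; T + 1 avoids a division by 0. *)
pose b := e / (2 * (T + 1) * (`|B1| + `|B3| + 2)).
have b0 : 0 < b by rewrite divr_gt0// !mulr_gt0// ?ltr_pwDr.
near=> n => /=.
have hU t : 0 <= t <= T -> nrm (U t - partial_sum n (U t)) < Num.min 1 b.
  move: t; near: n; apply: partial_sum_cvg_uniform => //.
  by rewrite lt_min ltr01.
have hW t : 0 <= t <= T -> nrm (W t - partial_sum n (W t)) < b.
  by move: t; near: n; exact: partial_sum_cvg_uniform.
have Dle t : 0 <= t <= T -> D n t <= (`|B1| + `|B3| + 2) * b.
  move=> tT; have := hU t tT; rewrite lt_min => /andP[hU1 hUb].
  have := hW t tT; have := HB1 t tT; have := HB3 t tT; rewrite /D.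
  have := ler_norm B1; have := ler_norm B3.
  have := nrm_ge0 (W t); have := nrm_ge0 (p (U t)).
  have := nrm_ge0 (W t - partial_sum n (W t)).
  have := nrm_ge0 (U t - partial_sum n (U t)).
  move: hU1 hUb; move: (nrm _) (nrm _) (nrm _) (nrm _) => x y z w.
  nra.
have := @increment_le _ (E n) (fun t => (`|B1| + `|B3| + 2) * b * t) (dE n)
  (fun=> (`|B1| + `|B3| + 2) * b) 0 T (EP n) _ T0.
rewrite /E !uE// -!sqr_nrm mulr0 subr0.
have -> : (`|B1| + `|B3| + 2) * b * T = e / 2 * (T / (T + 1)).
  by rewrite /b; field; rewrite !gt_eqF// ltr_pwDr.
have hT : T / (T + 1) <= 1 by rewrite ler_pdivrMr ?mul1r ?lerDl// ltr_pwDr.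
move=> h; suff : nrm (p (partial_sum n (U T))) ^+ 2 / 2 -
  nrm (p (partial_sum n (U 0))) ^+ 2 / 2 <= e / 2 * (T / (T + 1)).
  have : e / 2 * (T / (T + 1)) <= e / 2 by rewrite ger_pMr// divr_gt0.
  rewrite !fctE; lra.
apply: h => [t|t tT]; last exact: le_trans (dE_le n t tT) (Dle t tT).
by rewrite -[X in is_derive _ _ _ X]mulr1; apply: is_derive_mull.
Unshelve. all: by end_near. Qed.

End Orthonormal.
End SemiInner.

(** * Lebesgue measure on the plane *)

Section Plane.
Context (R : realType).
Local Notation T2 := (measurableTypeR R * measurableTypeR R)%type.

(** The sigma-algebra of the plane is the product one, so an open set is written
    as a countable union of boxes with rational vertices. *)
Lemma open_measurable_plane (A : set (R * R)) : open A -> measurable (A : set T2).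
Proof.
move=> oA.
pose box (q : rat * rat * (rat * rat)) : set T2 :=
  `]ratr q.1.1, ratr q.1.2[%classic `*` `]ratr q.2.1, ratr q.2.2[%classic.
have -> : A = \bigcup_(q : rat * rat * (rat * rat))
    (if `[< box q `<=` A >] then box q else set0).
  apply/seteqP; split => [x Ax|x [q _]]; last first.
    by case: asboolP => // h; exact: h.
  have /nbhs_ballP[e /= e0 xeA] := open_nbhs_nbhs (conj oA Ax).
  have lt1 (y : R) : y - e < y by rewrite ltrBlDr ltrDl.
  have lt2 (y : R) : y < y + e by rewrite ltrDl.
  have [a /[!in_itv]/= /andP[a1 a2]] := rat_in_itvoo (lt1 x.1).
  have [b /[!in_itv]/= /andP[b1 b2]] := rat_in_itvoo (lt2 x.1).
  have [c /[!in_itv]/= /andP[c1 c2]] := rat_in_itvoo (lt1 x.2).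
  have [d /[!in_itv]/= /andP[d1 d2]] := rat_in_itvoo (lt2 x.2).
  exists ((a, b), (c, d)) => //; case: asboolP => [_|h].
    by split; rewrite /= in_itv/= ?a2 ?b1 ?c2 ?d1.
  exfalso; apply: h => y [] /=; rewrite !in_itv/= => /andP[y1 y2] /andP[y3 y4].
  apply: xeA; split; rewrite /ball/= ltr_norml; lra.
apply: countable_bigcupT_measurable; first exact: countableP.
by move=> q; case: ifP => // _; exact: measurableX.
Qed.

Lemma continuous_measurable_plane (D : set (R * R)) (f : R * R -> R) :
  measurable (D : set T2) -> {within D, continuous f} ->
  measurable_fun (D : set T2) f.
Proof.
move=> mD /continuousP cf; apply: (measurability _ (RGenOpens.measurableE R)).
move=> _ [_ [a [b ->] <-]].
have oab : open `]a, b[%classic by exact: interval_open.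
have /open_subspaceP[V oV VD] := cf _ oab.
by rewrite setIC -VD; apply: measurableI => //; exact: open_measurable_plane.
Qed.

Lemma mu2_setX (A B : set (measurableTypeR R)) : measurable A -> measurable B ->
  mu2 R (A `*` B) = (lebesgue_measure A * lebesgue_measure B)%E.
Proof. exact: product_measure1E. Qed.

Lemma bounded_finite_plane (D : set (R * R)) :
  bounded_set D -> measurable (D : set T2) -> (mu2 R D < +oo)%E.
Proof.
move=> [M [_ /(_ (`|M| + 1))]] + mD.
rewrite (le_lt_trans (ler_norm M)) ?ltrDl// => /(_ isT) h.
pose r := `|M| + 1.
have Dr : D `<=` `[- r, r]%classic `*` `[- r, r]%classic.
  move=> x /h /=; rewrite [X in X <= _ -> _]/Num.norm/= ge_max.
  by move=> /andP[]; rewrite !ler_norml /= !in_itv.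
apply: (@le_lt_trans _ _ (mu2 R (`[- r, r]%classic `*` `[- r, r]%classic))).
  by apply: le_measure => //; rewrite inE//; exact: measurableX.
rewrite mu2_setX// lebesgue_measure_itv/=.
by case: ifP => _; rewrite ?mule0 // -EFinB -EFinM ltry.
Qed.

Lemma mu2_ball_gt0 (x : R * R) (e : R) : 0 < e -> (0 < mu2 R (ball x e))%E.
Proof.
move=> e0; have -> : ball x e = ball x.1 e `*` ball x.2 e by [].
rewrite mu2_setX; [|exact: open_measurable (ball_open _ _)..].
by rewrite !lebesgue_measure_ball ?mule_gt0 ?lte_fin ?mulrn_wgt0// ltW.
Qed.
End Plane.

(** * Square integrable functions *)

Section L2Space.
Context (R : realType) (Omega : set (R * R)).
Local Notation T2 := (measurableTypeR R * measurableTypeR R)%type.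
Local Notation mu := (mu2 R).
Hypothesis mOmega : measurable (Omega : set T2).
Hypothesis fOmega : (mu Omega < +oo)%E.
Implicit Types f g h : R * R -> R.
Local Notation L2 := (L2 Omega).
Local Notation ip := (L2inner Omega).

Lemma Lfun2P (f : T2 -> R) :
  f \in Lfun mu 2%:E <->
  measurable_fun setT f /\ mu.-integrable setT (EFin \o (fun x => f x ^+ 2)).
Proof.
split=> [fL|[mf /integrableP[_ fi]]].
  split; last exact: Lfun2_integrable_sqr.
  by move: fL; rewrite inE => /andP[]; rewrite inE.
rewrite inE; apply/andP; split; rewrite inE//=.
rewrite /finite_norm unlock; apply: poweR_lty; apply: le_lt_trans fi.
under eq_integral => x _ do rewrite /= powR_mulrn// -normrX.
exact: lexx.
Qed.

Lemma L2P f : L2 f <->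
  measurable_fun Omega (f : T2 -> R) /\ mu.-integrable Omega (EFin \o (fun x => f x ^+ 2)).
Proof.
split.
  move=> /Lfun2P[mf fi]; split; first exact/(measurable_restrictT f mOmega).
  apply/(integrable_mkcond _ mOmega); apply: eq_integrable fi => // x _.
  by rewrite /= /patch; case: ifP => // _; rewrite expr0n.
move=> [mf fi]; apply/Lfun2P; split; first exact/(measurable_restrictT f mOmega).
move/(integrable_mkcond _ mOmega) : fi; apply: eq_integrable => // x _.
by rewrite /= /patch; case: ifP => // _; rewrite expr0n.
Qed.

Lemma L2_le f g (C : R) : measurable_fun Omega (g : T2 -> R) ->
  (forall x, Omega x -> `|g x| <= C * `|f x|) -> L2 f -> L2 g.
Proof.
move=> mg gf /L2P[mf fi]; apply/L2P; split => //.
apply: (@le_integrable _ _ _ mu _ mOmega _ (fun x => (C ^+ 2)%:E * (f x ^+ 2)%:E)%E).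
- by apply/measurable_EFinP; exact: measurable_funX.
- move=> x Ox /=; rewrite lee_fin ger0_norm ?sqr_ge0// [leRHS]ger0_norm; last first.
    by rewrite mulr_ge0 ?sqr_ge0.
  have := gf x Ox; rewrite -[g x ^+ 2]real_normK ?num_real// -[f x ^+ 2]real_normK ?num_real// -exprMn.
  by move=> h; rewrite ler_sqr ?nnegrE// (le_trans _ h).
- exact: integrableZl.
Qed.

Lemma L2_bounded f (B : R) : measurable_fun Omega (f : T2 -> R) ->
  (forall x, Omega x -> `|f x| <= B) -> L2 f.
Proof.
move=> mf fB; apply: (@L2_le (cst 1) f B) => //.
  by move=> x Ox; rewrite normr1 mulr1; exact: fB.
apply/L2P; split => //=.
apply: measurable_bounded_integrable => //=.
exists 1; split; rewrite ?num_real// => M M1 x _ /=; rewrite expr1n normr1; exact: ltW.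
Qed.

Lemma L2D f g : L2 f -> L2 g -> L2 (fun x => f x + g x).
Proof.
move=> fL gL; rewrite /Defs.L2.
rewrite (_ : _ \_ _ = f \_ Omega + g \_ Omega).
  exact: (@Lfun_addr_closed _ T2 R mu 2%:E (lee1n 2)).2 _ _ fL gL.
by apply/funext => x; rewrite /patch !fctE; case: ifP => //; rewrite addr0.
Qed.

Lemma L2Z (a : R) f : L2 f -> L2 (fun x => a * f x).
Proof.
move=> fL; rewrite /Defs.L2.
rewrite (_ : _ \_ _ = a \o* (f \_ Omega)); first by apply: Lfun_scale; rewrite ?ler1n.
by apply/funext => x; rewrite /patch /=; case: ifP => //; rewrite ?mul0r// mulrC.
Qed.

Lemma L2_mul_integrable f g : L2 f -> L2 g ->
  mu.-integrable Omega (EFin \o (fun x => f x * g x)).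
Proof.
move=> fL gL; apply/(integrable_mkcond _ mOmega).
have /Lfun1_integrable := Lfun2_mul_Lfun1 fL gL.
apply: eq_integrable => // x _.
by rewrite /= /patch; case: ifP => // _; rewrite mul0r.
Qed.

Lemma L2innerE f g : L2 f -> L2 g ->
  (\int[mu]_(x in Omega) (f x * g x)%:E)%E = (ip f g)%:E.
Proof.
by move=> fL gL; rewrite /L2inner /Rintegral fineK// integrable_fin_num// L2_mul_integrable.
Qed.

Lemma L2normE f : L2 f -> L2norm Omega f = (Num.sqrt (ip f f))%:E.
Proof.
move=> fL; rewrite /L2norm unlock /= -powR12_sqrt; last first.
  by apply: Rintegral_ge0 => x _; rewrite -expr2 sqr_ge0.
rewrite -poweR_EFin -L2innerE//; congr (poweR _ _).
rewrite [RHS]integral_mkcond; apply: eq_integral => x _.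
by rewrite /= /patch; case: ifP => _; rewrite ?normr0 ?powR0 // powR_mulrn// real_normK ?num_real.
Qed.

End L2Space.

(** * Truncation to an interval *)

Section Truncation.
Context (R : realType).
Implicit Types M x y : R.

Definition clip M y : R := Num.max 0 (Num.min y M).

(** The signed distance to the interval [0, M]. *)
Definition excess M y : R := y - clip M y.

Variant excess_spec M y : R -> Type :=
| ExcessLow of y < 0 : excess_spec M y y
| ExcessMid of 0 <= y & y <= M : excess_spec M y 0
| ExcessHigh of M < y : excess_spec M y (y - M).

Lemma excessP M y : 0 <= M -> excess_spec M y (excess M y).
Proof.
move=> M0; rewrite /excess /clip /Num.max /Num.min.
have [yM|My|yM] := ltgtP y M; last rewrite -yM in M0 *.
- have [y0|y0] := ltP 0 y; first by rewrite subrr; constructor; exact: ltW.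
  have [->|yn0] := eqVneq y 0; first by rewrite subr0; constructor.
  by rewrite subr0; constructor; rewrite lt_neqAle yn0.
- have [y0|y0] := ltP 0 M; first by constructor.
  have -> : 0 = M by lra.
  by constructor.
- have [y0|y0] := ltP 0 y; first by rewrite subrr; constructor => //; exact: ltW.
  by rewrite subr0; have -> : y = 0; [lra|apply: ExcessMid].
Qed.

Lemma clipE M y : clip M y = y - excess M y.
Proof. by rewrite /excess subKr. Qed.

Lemma clip_itv M y : 0 <= M -> 0 <= clip M y <= M.
Proof. by move=> M0; rewrite clipE; case: (excessP y M0); lra. Qed.

Lemma clip_id M y : 0 <= y <= M -> clip M y = y.
Proof.
move=> /andP[y0 yM]; have M0 := le_trans y0 yM.
by rewrite clipE; case: (excessP y M0); lra.
Qed.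

Lemma clip_lip M y z : 0 <= M -> `|clip M y - clip M z| <= `|y - z|.
Proof.
move=> M0; rewrite !clipE.
wlog yz : y z / z <= y.
  by move=> H; have [/H//|/ltW/H h] := leP z y; rewrite distrC (le_trans h)// distrC.
rewrite [X in _ <= X]ger0_norm ?subr_ge0// ler_norml.
by case: (excessP y M0); case: (excessP z M0) => *; lra.
Qed.

Lemma excess_lip M y z : 0 <= M -> `|excess M y - excess M z| <= `|y - z|.
Proof.
move=> M0.
wlog yz : y z / z <= y.
  by move=> H; have [/H//|/ltW/H h] := leP z y; rewrite distrC (le_trans h)// distrC.
rewrite [X in _ <= X]ger0_norm ?subr_ge0// ler_norml.
by case: (excessP y M0); case: (excessP z M0) => *; lra.
Qed.

Lemma excess_obtuse M x y : 0 <= M ->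
  0 <= (x - excess M x - (y - excess M y)) * excess M x.
Proof. by move=> M0; case: (excessP x M0); case: (excessP y M0) => *; nra. Qed.

Lemma norm_excess_le M y : 0 <= M -> `|excess M y| <= `|y|.
Proof.
move=> M0; case: (excessP y M0) => *; rewrite ?normr0//.
by rewrite !ger0_norm; lra.
Qed.

Lemma measurable_excess M : measurable_fun setT (excess M).
Proof.
apply: measurable_funB => //; apply: measurable_maxr => //.
exact: measurable_minr.
Qed.

End Truncation.

(** * L^2 of a domain as a semi-inner product space *)

Section L2Hilbert.
Context (R : realType) (Omega : set (R * R)).
Local Notation T2 := (measurableTypeR R * measurableTypeR R)%type.
Local Notation mu := (mu2 R).
Hypothesis mOmega : measurable (Omega : set T2).
Local Notation L2 := (L2 Omega).
Local Notation ip := (L2inner Omega).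

(** Functions on the plane that are square integrable; the inner product below
    only sees their values on the domain. *)
Definition L2space : lmodType R := LfunType (mu2 R) (lee1n 2).

Definition toL2 (f : R * R -> R) : L2space := insubd (0 : L2space) (f \_ Omega).

Definition ipL2 (u v : L2space) : R := ip u v.

Lemma toL2_val f : L2 f -> toL2 f = f \_ Omega :> (R * R -> R).
Proof. by move=> fL; rewrite /toL2 /insubd insubT. Qed.

Lemma L2spaceD (u v : L2space) x : (u + v) x = u x + v x. Proof. by []. Qed.
Lemma L2spaceB (u v : L2space) x : (u - v) x = u x - v x. Proof. by []. Qed.
Lemma L2spaceZ (a : R) (u : L2space) x : (a *: u) x = a * u x. Proof. by []. Qed.

Lemma sum_L2spaceE n (a : 'I_n -> R) (u : 'I_n -> L2space) x :
  (\sum_(k < n) a k *: u k) x = \sum_(k < n) a k * u k x.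
Proof.
elim: n a u => [|n IH] a u; first by rewrite !big_ord0.
by rewrite !big_ord_recr /= -IH.
Qed.

Lemma toL2E f x : L2 f -> Omega x -> toL2 f x = f x.
Proof. by move=> fL Ox; rewrite toL2_val// patchE mem_set. Qed.

Lemma L2space_L2 (u : L2space) : L2 u.
Proof.
have /Lfun2P[mu' iu] := LfunP u; apply/(L2P mOmega); split.
  exact: measurable_funTS.
exact: integrableS iu.
Qed.

Lemma eq_L2inner f f' g g' : (forall x, Omega x -> f x = f' x) ->
  (forall x, Omega x -> g x = g' x) -> ip f g = ip f' g'.
Proof.
move=> ff' gg'; apply: eq_Rintegral => x /set_mem Ox; by rewrite ff'// gg'.
Qed.

Lemma eq_ipL2 (u u' v v' : L2space) : (forall x, Omega x -> u x = u' x) ->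
  (forall x, Omega x -> v x = v' x) -> ipL2 u v = ipL2 u' v'.
Proof. exact: eq_L2inner. Qed.

Lemma ipL2_toL2 f g : L2 f -> L2 g -> ipL2 (toL2 f) (toL2 g) = ip f g.
Proof. by move=> fL gL; apply: eq_L2inner => x Ox; rewrite toL2E. Qed.

Lemma le_L2inner f f' g g' : L2 f -> L2 f' -> L2 g -> L2 g' ->
  (forall x, Omega x -> f x * f' x <= g x * g' x) -> ip f f' <= ip g g'.
Proof.
by move=> fL f'L gL g'L h; apply: le_Rintegral => //; exact: L2_mul_integrable.
Qed.

Lemma le_ipL2 (u u' v v' : L2space) :
  (forall x, Omega x -> u x * u' x <= v x * v' x) -> ipL2 u u' <= ipL2 v v'.
Proof. by apply: le_L2inner; exact: L2space_L2. Qed.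

Lemma semi_inner_ipL2 : semi_inner ipL2.
Proof.
split.
- by move=> u v; apply: eq_Rintegral => x _; rewrite mulrC.
- move=> u v w; rewrite /ipL2 /L2inner -RintegralD//; last 2 first.
    by apply: L2_mul_integrable => //; exact: L2space_L2.
    by apply: L2_mul_integrable => //; exact: L2space_L2.
  by apply: eq_Rintegral => x _; rewrite -mulrDl.
- move=> a u v; rewrite /ipL2 /L2inner -RintegralZl//; last first.
    by apply: L2_mul_integrable => //; exact: L2space_L2.
  by apply: eq_Rintegral => x _; rewrite mulrA.
- by move=> u; apply: Rintegral_ge0 => x _; rewrite -expr2 sqr_ge0.
Qed.

Local Notation nrm := (nrm ipL2).

Lemma eq_nrm_L2 (u v : L2space) : (forall x, Omega x -> u x = v x) -> nrm u = nrm v.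
Proof. by move=> uv; congr Num.sqrt; exact: eq_ipL2. Qed.

Lemma ipL2_ge0 (u v : L2space) : (forall x, Omega x -> 0 <= u x * v x) -> 0 <= ipL2 u v.
Proof. by move=> uv; apply: Rintegral_ge0 => x Ox; exact: uv. Qed.

Lemma nrm_subr_eq0 (u v : L2space) : (forall x, Omega x -> u x = v x) -> nrm (u - v) = 0.
Proof.
move=> uv; rewrite /nrm (eq_ipL2 (u' := 0) (v' := 0)) ?(ip0l semi_inner_ipL2) ?sqrtr0//;
  by move=> x Ox; rewrite L2spaceB uv// subrr.
Qed.

Lemma L2norm_nrm f : L2 f -> L2norm Omega f = (nrm (toL2 f))%:E.
Proof. by move=> fL; rewrite L2normE// /nrm ipL2_toL2. Qed.

Lemma L2B f g : L2 f -> L2 g -> L2 (fun x => f x - g x).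
Proof.
move=> fL gL; rewrite (_ : (fun x => _) = (fun x => f x + -1 * g x)).
  by apply: L2D => //; exact: L2Z.
by apply/funext => x; rewrite mulN1r.
Qed.

Lemma nrm_toL2B f g : L2 f -> L2 g ->
  nrm (toL2 (fun x => f x - g x)) = nrm (toL2 f - toL2 g).
Proof.
move=> fL gL; apply: eq_nrm_L2 => x Ox; rewrite toL2E//; last exact: L2B.
by rewrite L2spaceB !toL2E.
Qed.

Lemma L2cvgP (f_ : nat -> R * R -> R) f : (forall n, L2 (f_ n)) -> L2 f ->
  L2cvg Omega f_ f <-> nrm (toL2 (f_ n) - toL2 f) @[n --> \oo] --> 0.
Proof.
move=> fnL fL; rewrite /L2cvg.
rewrite (_ : (fun n => _) = EFin \o (fun n => nrm (toL2 (f_ n) - toL2 f))).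
  by split => [/fine_cvg|h]; last by apply: cvg_EFin; [exact: nearW|exact: h].
by apply/funext => n /=; rewrite L2norm_nrm ?nrm_toL2B//; exact: L2B.
Qed.

Definition excessL2 (M : R) (u : L2space) : L2space := toL2 (excess M \o u).

Lemma L2_excess M f : 0 <= M -> L2 f -> L2 (excess M \o f).
Proof.
move=> M0 fL; apply: (@L2_le _ _ mOmega f _ 1) => //.
  apply: (measurableT_comp _ (proj1 (proj1 (L2P mOmega f) fL))).
  exact: measurable_excess.
by move=> x Ox; rewrite mul1r; exact: norm_excess_le.
Qed.

Lemma excessL2E M u x : 0 <= M -> Omega x -> excessL2 M u x = excess M (u x).
Proof. by move=> M0 Ox; rewrite toL2E//; apply: L2_excess => //; exact: L2space_L2. Qed.

(** Integral of the obtuse-angle inequality for the interval [0, M]. *)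
Lemma projection_residual_excessL2 M : 0 <= M ->
  projection_residual ipL2 (excessL2 M).
Proof.
move=> M0 u v; apply: Rintegral_ge0 => x Ox.
rewrite -[X in X * _]/(u x - excessL2 M u x - (v x - excessL2 M v x)).
by rewrite !excessL2E//; exact: excess_obtuse.
Qed.

End L2Hilbert.

(* The lemmas above characterize these; unfolding them makes failing unifications
   compare integrals. *)
Global Opaque ipL2 toL2 excessL2.

(** * Smooth functions *)

(** Reduces directional derivatives to derivatives of functions of one variable,
    to which the chain rule and the fundamental theorem of calculus apply. *)
Lemma is_derive_line (R : numFieldType) (V W : normedModType R) (f : V -> W)
    (x v : V) (s : R) (df : W) :
  is_derive (s *: v + x) v f df <-> is_derive s 1 (fun t => f (t *: v + x)) df.
Proof.
have E : (fun h : R => h^-1 *: ((f \o shift (s *: v + x)) (h *: v) - f (s *: v + x)))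
       = (fun h : R => h^-1 *: (((fun t => f (t *: v + x)) \o shift s) (h *: 1) -
                               f (s *: v + x))).
  by apply/funext => h /=; rewrite scalerDl addrA [h *: 1]mulr1.
by split => -[d e]; apply: DeriveDef; move: d e; rewrite /derivable /derive /= E.
Qed.

Section Smooth.
Context (R : realType).
Implicit Types (f g psi : R * R -> R) (i : bool) (x : R * R).

(** The algebra of functions generated by S. *)
Inductive generated (S : (R * R -> R) -> Prop) : (R * R -> R) -> Prop :=
| GeneratedBase f : S f -> generated S f
| GeneratedCst c : generated S (cst c)
| GeneratedAdd f g : generated S f -> generated S g -> generated S (fun x => f x + g x)
| GeneratedMul f g : generated S f -> generated S g -> generated S (fun x => f x * g x).

Lemma pdD i f g : (forall x, derivable f x (axis i)) ->
  (forall x, derivable g x (axis i)) ->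
  pd i (fun x => f x + g x) = (fun x => pd i f x + pd i g x).
Proof. by move=> df dg; apply/funext => x; rewrite /pd deriveD. Qed.

Lemma pdM i f g : (forall x, derivable f x (axis i)) ->
  (forall x, derivable g x (axis i)) ->
  pd i (fun x => f x * g x) = (fun x => f x * pd i g x + pd i f x * g x).
Proof.
move=> df dg; apply/funext => x; rewrite /pd deriveM//; congr (_ + _).
by rewrite mulrC.
Qed.

Lemma pd_cst i (c : R) : pd i (cst c) = cst 0 :> (R * R -> R).
Proof. by apply/funext => x; rewrite /pd derive_cst. Qed.

(** The algebra generated by a family S is stable under partial derivatives as
    soon as it contains those of the members of S. *)
Lemma generated_smooth (S : (R * R -> R) -> Prop) :
  (forall f, S f -> [/\ continuous f, forall i x, derivable f x (axis i)
                      & forall i, generated S (pd i f)]) ->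
  forall f, generated S f -> smooth f.
Proof.
move=> HS.
have H f : generated S f -> [/\ continuous f, forall i x, derivable f x (axis i)
                      & forall i, generated S (pd i f)].
  elim => {f} [f /HS//|c|f g Gf [cf df pf] Gg [cg dg pg]|f g Gf [cf df pf] Gg [cg dg pg]].
  - split => [x|i x|i]; [exact: cvg_cst|exact: derivable_cst|].
    by rewrite pd_cst; exact: GeneratedCst.
  - split => [x|i x|i]; [apply: cvgD; [exact: cf|exact: cg]|exact: derivableD|].
    by rewrite pdD//; exact: GeneratedAdd.
  - split => [x|i x|i]; [apply: cvgM; [exact: cf|exact: cg]|exact: derivableM|].
    rewrite pdM//; apply: GeneratedAdd; exact: GeneratedMul.
move=> f Gf s.
have Gs : generated S (foldr pd f s).
  by elim: s => //= i s /H[].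
by have [] := H _ Gs.
Qed.

Lemma smooth_pd f i : smooth f -> smooth (pd i f).
Proof.
move=> sf s; rewrite (_ : foldr pd (pd i f) s = foldr pd f (rcons s i)) //.
by rewrite foldr_rcons.
Qed.

Lemma smooth_continuous f : smooth f -> continuous f.
Proof. by move=> /(_ [::])[]. Qed.

Lemma smooth_derivable f i x : smooth f -> derivable f x (axis i).
Proof. by move=> /(_ [::])[]. Qed.

Let smooth_gen (f : R * R -> R) : generated smooth f -> smooth f.
Proof.
apply: generated_smooth => g sg; split.
- exact: smooth_continuous.
- by move=> i x; exact: smooth_derivable.
- by move=> i; apply: GeneratedBase; exact: smooth_pd.
Qed.

Lemma smooth_cst (c : R) : smooth (cst c : R * R -> R).
Proof. by apply: smooth_gen; exact: GeneratedCst. Qed.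

Lemma smoothD f g : smooth f -> smooth g -> smooth (fun x => f x + g x).
Proof. by move=> *; apply: smooth_gen; apply: GeneratedAdd; exact: GeneratedBase. Qed.

Lemma smoothM f g : smooth f -> smooth g -> smooth (fun x => f x * g x).
Proof. by move=> *; apply: smooth_gen; apply: GeneratedMul; exact: GeneratedBase. Qed.

(** A smooth substitute for the absolute value. *)
Definition regabs (d y : R) : R := Num.sqrt (y ^+ 2 + d ^+ 2).

Lemma regabs_gt0 d y : 0 < d -> 0 < regabs d y.
Proof. by move=> d0; rewrite sqrtr_gt0 ltr_wpDl ?sqr_ge0// exprn_gt0. Qed.

Lemma is_derive_regabs_comp d f x v df : 0 < d -> is_derive x v f df ->
  is_derive x v (fun z => regabs d (f z)) (f x / regabs d (f x) * df).
Proof.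
move=> d0 dfx.
have x0 : x = 0 *: v + x by rewrite scale0r add0r.
have {}dfx : is_derive (0 *: v + x) v f df by rewrite -x0.
rewrite [X in is_derive X]x0; apply/(is_derive_line (fun z => regabs d (f z))).
move: dfx => /(is_derive_line f).
set q := (fun t => f (t *: v + x)); have -> : f x = q 0 by rewrite /q -x0.
move=> dq.
have q0 : 0 < q 0 ^+ 2 + d ^+ 2 by rewrite ltr_wpDl ?sqr_ge0// exprn_gt0.
have d2 : is_derive (0 : R) 1 (fun h => q h ^+ 2 + d ^+ 2) (2 * q 0 * df).
  rewrite (_ : 2 * q 0 * df = (q 0 *: df + q 0 *: df) + 0); last first.
    by rewrite addr0 /GRing.scale/=; ring.
  rewrite (_ : (fun h => _) = q * q + cst (d ^+ 2)).
    by apply: is_deriveD; apply: is_deriveM.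
  by apply/funext => h; rewrite !fctE expr2.
have := @is_derive1_comp R Num.sqrt (fun h => q h ^+ 2 + d ^+ 2) 0 _ _
  (is_derive1_sqrt q0) d2.
rewrite (_ : _ * _ = q 0 / regabs d (q 0) * df)//.
by have := regabs_gt0 (q 0) d0; rewrite /regabs => ?; field; rewrite gt_eqF.
Qed.

(** With [r x = regabs d (f x)], the partial derivatives of r and 1 / r are
    [f * (1 / r) * pd i f] and [- (1 / r) ^+ 2 * pd i r], polynomials in smooth
    functions, r and 1 / r. *)
Lemma smooth_regabs d f : 0 < d -> smooth f -> smooth (fun x => regabs d (f x)).
Proof.
move=> d0 sf; pose r x := regabs d (f x).
have r0 x : r x != 0 by rewrite gt_eqF// regabs_gt0.
pose S h := [\/ smooth h, h = r | h = (fun x => (r x)^-1)].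
have dr i x : is_derive x (axis i) r (f x / r x * pd i f x).
  apply: is_derive_regabs_comp => //; exact/derivableP/smooth_derivable.
have cr : continuous r.
  move=> x; apply: (@continuous_comp _ _ _ (fun z => f z * f z + d ^+ 2) Num.sqrt).
    by apply: cvgD; [apply: cvgM; exact: smooth_continuous|exact: cvg_cst].
  exact: sqrt_continuous.
have pr i : generated S (pd i r).
  rewrite (_ : pd i r = fun x => f x * (r x)^-1 * pd i f x); last first.
    by apply/funext => x; rewrite /pd derive_val.
  apply: GeneratedMul; last by apply: GeneratedBase; apply: Or31; exact: smooth_pd.
  by apply: GeneratedMul; apply: GeneratedBase; [exact: Or31|exact: Or33].
apply: (@generated_smooth S); last by apply: GeneratedBase; exact: Or32.
move=> h [sh|->|->]; split => //.
- exact: smooth_continuous.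
- by move=> i x; exact: smooth_derivable.
- by move=> i; apply: GeneratedBase; apply: Or31; exact: smooth_pd.
- by move=> x; apply: cvgV => //; exact: cr.
- by move=> i x; apply: derivableV => //; case: (dr i x).
- move=> i; rewrite (_ : pd i _ = fun x => cst (-1) x * ((r x)^-1 * (r x)^-1) * pd i r x).
    apply: GeneratedMul => //; apply: GeneratedMul; first exact: GeneratedCst.
    by apply: GeneratedMul; apply: GeneratedBase; exact: Or33.
  apply/funext => x; rewrite /pd deriveV//.
  by rewrite /cst -exprVn /GRing.scale/=; ring.
Qed.

End Smooth.

(** * Smooth truncation *)

Section RegularizedExcess.
Context (R : realType).
Implicit Types (d M y z : R) (f : R * R -> R).

Lemma sqr_regabs d y : regabs d y ^+ 2 = y ^+ 2 + d ^+ 2.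
Proof. by rewrite sqr_sqrtr// addr_ge0 ?sqr_ge0. Qed.

Lemma norm_le_regabs d y : `|y| <= regabs d y.
Proof. by rewrite -sqrtr_sqr ler_wsqrtr// lerDl sqr_ge0. Qed.

Lemma regabs_le d y : 0 <= d -> regabs d y <= `|y| + d.
Proof.
move=> d0; rewrite -ler_sqr ?nnegrE ?sqrtr_ge0 ?addr_ge0// sqr_regabs.
by rewrite -[y ^+ 2]real_normK ?num_real//; have := normr_ge0 y; nra.
Qed.

Lemma regabs_lip d y z : 0 < d -> `|regabs d y - regabs d z| <= `|y - z|.
Proof.
move=> d0; have py := regabs_gt0 y d0; have pz := regabs_gt0 z d0.
rewrite -(ler_pM2r (addr_gt0 py pz)) -[X in _ * X <= _]gtr0_norm ?addr_gt0// -normrM.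
rewrite (_ : _ * _ = (y - z) * (y + z)); last first.
  have := sqr_regabs d y; have := sqr_regabs d z; rewrite !expr2; lra.
rewrite normrM ler_wpM2l// (le_trans (ler_normD _ _))//.
by rewrite lerD// norm_le_regabs.
Qed.

(** Since [max 0 (min y M) = (|y| - |y - M| + M) / 2], this is a smooth
    approximation of [excess M], shifted so as to vanish at 0. *)
Definition regexcess d M y : R :=
  y - (regabs d y - regabs d (y - M) + regabs d M - d) / 2.

(** The derivative of [regexcess d M]; it is nonnegative and bounded uniformly in
    d, which is what survives as d tends to 0. *)
Definition dregexcess d M y : R :=
  1 - (y / regabs d y - (y - M) / regabs d (y - M)) / 2.

Lemma regabs0 d : 0 <= d -> regabs d 0 = d.
Proof. by move=> d0; rewrite /regabs expr0n add0r sqrtr_sqr ger0_norm. Qed.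

Lemma regabsN d y : regabs d (- y) = regabs d y.
Proof. by rewrite /regabs sqrrN. Qed.

Lemma regexcess0 d M : 0 <= d -> regexcess d M 0 = 0.
Proof. by move=> d0; rewrite /regexcess !sub0r regabsN regabs0//; lra. Qed.

Lemma regexcess_lip d M y z : 0 < d ->
  `|regexcess d M y - regexcess d M z| <= 2 * `|y - z|.
Proof.
move=> d0; have h1 := regabs_lip y z d0; have h2 := regabs_lip (y - M) (z - M) d0.
rewrite /regexcess.
have e : y - M - (z - M) = y - z by ring.
rewrite e in h2; move: h1 h2; have [h|h] := lerP 0 (y - z).
  by rewrite (ger0_norm h) !ler_norml; lra.
by rewrite (ltr0_norm h) !ler_norml; lra.
Qed.

Lemma regexcess_approx d M y : 0 < d -> 0 <= M -> `|regexcess d M y - excess M y| <= d.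
Proof.
move=> d0 M0; have h z := conj (norm_le_regabs d z) (regabs_le z (ltW d0)).
rewrite /regexcess; have := h y; have := h (y - M); have := h M.
move=> [h1 h2] [h3 h4] [h5 h6].
rewrite (ger0_norm M0) in h1 h2.
have : excess M y = y - (`|y| - `|y - M| + M) / 2.
  case: (excessP y M0) => [y0|y0 yM|My].
  - by rewrite (ltr0_norm y0) ltr0_norm; lra.
  - by rewrite (ger0_norm y0) ler0_norm; lra.
  - by rewrite !ger0_norm; lra.
by rewrite ler_norml => ->; lra.
Qed.

Lemma dregexcess_bounds d M y : 0 < d -> 0 <= dregexcess d M y <= 2.
Proof.
move=> d0; have h z : -1 <= z / regabs d z <= 1.
  rewrite ler_pdivlMr ?ler_pdivrMr ?regabs_gt0//.
  by have := norm_le_regabs d z; rewrite ler_norml; lra.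
by have := h y; have := h (y - M); rewrite /dregexcess; lra.
Qed.

Lemma smooth_regexcess d M f : 0 < d -> smooth f ->
  smooth (fun x => regexcess d M (f x)).
Proof.
move=> d0 sf.
have sfM : smooth (fun x => f x + cst (- M) x) by apply: smoothD => //; exact: smooth_cst.
have := smoothD (smoothD sf (smoothM (smooth_cst (- 2^-1)) (smooth_regabs d0 sf)))
   (smoothD (smoothM (smooth_cst (2^-1)) (smooth_regabs d0 sfM))
   (smooth_cst (- ((regabs d M - d) / 2)))).
congr smooth; apply/funext => x; rewrite /regexcess /=; lra.
Qed.

Lemma pd_regexcess d M f i : 0 < d -> smooth f ->
  pd i (fun x => regexcess d M (f x)) = (fun x => dregexcess d M (f x) * pd i f x).
Proof.
move=> d0 sf; apply/funext => x.
have df : is_derive x (axis i) f (pd i f x) by exact/derivableP/smooth_derivable.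
have dfM : is_derive x (axis i) (fun x => f x - M) (pd i f x).
  rewrite -[X in is_derive _ _ _ X]subr0; apply: is_deriveB.
have d1 := is_deriveB (is_derive_regabs_comp d0 df) (is_derive_regabs_comp d0 dfM).
have d2 := is_deriveB (is_deriveB df (is_derive_mull 2^-1 d1))
  (is_derive_cst ((regabs d M - d) / 2) x (axis i)).
apply: (etrans _ (etrans (@derive_val _ _ _ _ _ _ _ d2) _)).
  congr (derive _ x (axis i)).
  by apply/funext => z; rewrite !fctE /regexcess; lra.
by rewrite /dregexcess; ring.
Qed.

End RegularizedExcess.

(** * Test functions and integration by parts *)

Section TestFunctions.
Context (R : realType) (Omega : set (R * R)).
Local Notation T2 := (measurableTypeR R * measurableTypeR R)%type.
Local Notation mu := (mu2 R).
Implicit Types (f g psi : R * R -> R).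

Local Notation supp f := (closure [set x | f x != 0]).
Local Notation test := (test_function Omega).

Lemma test_function_sub (K : set (R * R)) f : compact K -> K `<=` Omega ->
  smooth f -> [set x | f x != 0] `<=` K -> test f.
Proof.
move=> cK KO sf fK.
have sK : supp f `<=` K.
  apply: (subset_trans (closureS fK)).
  by have /compact_closed := cK; rewrite closure_id => /(_ (@norm_hausdorff _ _)) <-.
split => //; last exact: subset_trans KO.
by apply: subclosed_compact cK sK; exact: closed_closure.
Qed.

Lemma test_function_pd f i : test f -> test (pd i f).
Proof.
move=> [sf cf fO]; apply: (test_function_sub cf fO); first exact: smooth_pd.
move=> x /= pfx; apply: contrapT => nx; move/eqP: pfx; apply.
have : \forall y \near x, f y = 0.
  have : nbhs x (~` supp f) by apply: open_nbhs_nbhs; split => //; exact/closed_openC/closed_closure.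
  apply: filterS => y ny; apply: contrapT => /eqP fy; apply: ny; exact: subset_closure.
move=> f0; rewrite /pd.
have h : is_derive x (axis i) f 0.
  apply: (@near_eq_is_derive _ _ _ (cst 0)); first by apply: filterS f0 => y ->.
by rewrite derive_val.
Qed.

Lemma test_functionD f g : test f -> test g -> test (fun x => f x + g x).
Proof.
move=> [sf cf fO] [sg cg gO].
apply: (@test_function_sub (supp f `|` supp g)).
- exact: compactU.
- by rewrite subUset.
- exact: smoothD.
- move=> x /= fg; have [f0|fn0] := eqVneq (f x) 0.
    by right; apply: subset_closure => /=; move: fg; rewrite f0 add0r.
  by left; exact: subset_closure.
Qed.

Lemma test_functionM f g : test f -> smooth g -> test (fun x => f x * g x).
Proof.
move=> [sf cf fO] sg; apply: (test_function_sub cf fO); first exact: smoothM.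
move=> x /=; rewrite mulf_eq0 negb_or => /andP[fx _]; exact: subset_closure.
Qed.

Lemma test_functionZ (a : R) f : test f -> test (fun x => a * f x).
Proof.
move=> tf; rewrite (_ : (fun x => _) = (fun x => f x * cst a x)).
  by apply: test_functionM => //; exact: smooth_cst.
by apply/funext => x; rewrite mulrC.
Qed.

Lemma test_function0 : test (cst 0).
Proof.
apply: (@test_function_sub set0) => //; [exact: compact0|exact: smooth_cst|].
by move=> x /=; rewrite eqxx.
Qed.

Lemma test_function_sum n (a : 'I_n -> R) (f : 'I_n -> R * R -> R) :
  (forall k, test (f k)) -> test (fun x => \sum_(k < n) a k * f k x).
Proof.
move=> tf; elim: n a f tf => [|n IH] a f tf.
  by under eq_fun do rewrite big_ord0; exact: test_function0.
under eq_fun do rewrite big_ord_recr /=.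
by apply: test_functionD; [exact: IH|exact: test_functionZ].
Qed.

Lemma test_function_regexcess d M f : 0 < d -> test f ->
  test (fun x => regexcess d M (f x)).
Proof.
move=> d0 [sf cf fO]; apply: (test_function_sub cf fO); first exact: smooth_regexcess.
move=> x /= kf; apply: subset_closure => /=; apply: contra_neq kf => ->.
by rewrite regexcess0// ltW.
Qed.

Lemma test_function_bounded f : test f -> exists B, forall x, `|f x| <= B.
Proof.
move=> [sf cf _].
have : compact (f @` supp f).
  apply: continuous_compact => //; apply: continuous_subspaceT.
  exact: smooth_continuous.
move=> /compact_bounded[M [_ /(_ (`|M| + 1))]].
rewrite (le_lt_trans (ler_norm M)) ?ltrDl// => /(_ isT) h.
exists (`|M| + 1) => x; have [->|fx] := eqVneq (f x) 0; first by rewrite normr0 addr_ge0.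
by apply: h; exists x => //; exact: subset_closure.
Qed.

Lemma test_function_out f : test f -> exists r, 0 < r /\
  forall x, r <= `|x| -> f x = 0.
Proof.
move=> [sf cf _]; have [M [_ /(_ (`|M| + 1))]] := compact_bounded cf.
rewrite (le_lt_trans (ler_norm M)) ?ltrDl// => /(_ isT) h.
exists (`|M| + 2); split; first by rewrite ltr_wpDl.
move=> x rx; apply: contrapT => /eqP fx.
have /h/= : supp f x by exact: subset_closure.
move: rx; lra.
Qed.

Hypothesis oOmega : open Omega.
Hypothesis bOmega : bounded_set Omega.
Let mOmega : measurable (Omega : set T2) := open_measurable_plane oOmega.
Let fOmega : (mu Omega < +oo)%E := bounded_finite_plane bOmega mOmega.

Lemma test_function_L2 f : test f -> L2 Omega f.
Proof.
move=> tf; have [B fB] := test_function_bounded tf.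
apply: (L2_bounded mOmega fOmega (B := B)) => //.
apply: measurable_funTS; apply: continuous_measurable_plane => //.
by apply: continuous_subspaceT; apply: smooth_continuous; case: tf.
Qed.

Lemma integral_derive_out (g dg : R -> R) (r : R) : 0 < r ->
  (forall s : R, is_derive s 1 g (dg s)) -> continuous dg ->
  (forall s, r <= `|s| -> g s = 0) -> (forall s, r <= `|s| -> dg s = 0) ->
  (\int[@lebesgue_measure R]_s (dg s)%:E = 0)%E.
Proof.
move=> r0 hg cdg g0 dg0.
transitivity (\int[@lebesgue_measure R]_(s in `[(- r)%R, r]) (dg s)%:E)%E.
  rewrite [RHS]integral_mkcond; apply: eq_integral => s _.
  rewrite /= patchE; case: ifPn => //; rewrite notin_setE/= in_itv/= => /negP.
  by rewrite -ler_norml -ltNge => /ltW/dg0 ->.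
rewrite (@continuous_FTC2 _ dg g)//.
- by rewrite !g0 ?subee ?normrN ?ler_norm.
- by rewrite (lt_trans _ r0)// oppr_lt0.
- exact: continuous_subspaceT.
- have cg : continuous g.
    move=> s; apply: differentiable_continuous; apply/derivable1_diffP.
    by case: (hg s).
  split => [s _||]; first by case: (hg s).
    exact: cvg_at_right_filter (cg _).
  exact: cvg_at_left_filter (cg _).
- by move=> s _; rewrite derive1E derive_val.
Qed.

(** On each line parallel to the i-th axis the integral vanishes by the
    fundamental theorem of calculus, as f is 0 at both ends; Fubini's theorem
    concludes. *)
Lemma integral_pd_test f i : test f -> (\int[mu]_(x in Omega) (pd i f x)%:E = 0)%E.
Proof.
move=> tf; have tpf := test_function_pd i tf; have [[sf _ _] [spf _ pfO]] := (tf, tpf).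
have ipf : mu.-integrable setT (EFin \o pd i f).
  rewrite (_ : _ \o _ = (EFin \o pd i f) \_ Omega); last first.
    apply/funext => x; rewrite patchE; case: ifPn => //; rewrite notin_setE => nx.
    rewrite /=; congr EFin; apply: contrapT => /eqP h; apply: nx; apply: pfO.
    exact: subset_closure.
  apply/(integrable_mkcond _ mOmega); apply: measurable_bounded_integrable => //.
    apply: measurable_funTS; apply: continuous_measurable_plane => //.
    by apply: continuous_subspaceT; apply: smooth_continuous.
  have [B fB] := test_function_bounded tpf.
  by exists B; split; rewrite ?num_real// => M BM x _ /=; rewrite (le_trans (fB x))// ltW.
transitivity (\int[mu]_x (pd i f x)%:E)%E.
  rewrite [LHS]integral_mkcond; apply: eq_integral => x _; rewrite patchE.
  case: ifPn => //; rewrite notin_setE => nx.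
  congr EFin; apply: contrapT => /eqP h; apply: nx; apply: pfO.
  by apply: subset_closure; rewrite /= eq_sym.
have [r1 [r10 fr]] := test_function_out tf.
have [r2 [r20 pfr]] := test_function_out tpf.
pose r := Num.max r1 r2.
have r0 : 0 < r by rewrite lt_max r10.
have zero_out (x : R * R) : (r <= `|x.1|) || (r <= `|x.2|) -> f x = 0 /\ pd i f x = 0.
  move=> rx; have : r <= `|x| by rewrite [X in _ <= X]/Num.norm/= le_max.
  by rewrite ge_max => /andP[/fr -> /pfr ->].
have line_derive (y : R * R) (s : R) :
    is_derive s 1 (fun t => f (t *: axis i + y)) (pd i f (s *: axis i + y)).
  by apply/(is_derive_line f); apply/derivableP; exact: smooth_derivable.
have line_cont (y : R * R) : continuous (fun t : R => pd i f (t *: axis i + y)).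
  move=> t; apply: (@continuous_comp _ _ _ (fun t : R => t *: axis i + y) (pd i f)).
    apply: cvgD; last exact: cvg_cst.
    by apply: cvgZr_tmp; exact: cvg_id.
  exact: smooth_continuous.
have lineE (b : bool) (x y : R) : i = b ->
    (x, y) = (if b then y else x) *: axis i + (if b then (x, 0) else (0, y)).
  move=> ->; rewrite /axis; case: b; congr (_, _) => /=; rewrite /GRing.scale/=; ring.
have [ib|ib] : i = true \/ i = false by case: (i); [left|right].
  rewrite -integral12_prod_meas1//; apply: integral0_eq => x _.
  rewrite /fubini_F; under eq_integral => y _ do rewrite (lineE true x y ib).
  apply: (integral_derive_out r0 (line_derive (x, 0))) => // s rs;
    by rewrite -(lineE true x s ib); have [] := zero_out (x, s); rewrite //= rs orbT.
rewrite -integral21_prod_meas1//; apply: integral0_eq => y _.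
rewrite /fubini_G; under eq_integral => x _ do rewrite (lineE false x y ib).
apply: (integral_derive_out r0 (line_derive (0, y))) => // s rs;
  by rewrite -(lineE false s y ib); have [] := zero_out (s, y); rewrite //= rs.
Qed.

End TestFunctions.

(** * The Dirichlet form *)

Section DirichletForm.
Context (R : realType) (Omega : set (R * R)).
Local Notation T2 := (measurableTypeR R * measurableTypeR R)%type.
Local Notation mu := (mu2 R).
Hypothesis oOmega : open Omega.
Hypothesis bOmega : bounded_set Omega.
Let mOmega : measurable (Omega : set T2) := open_measurable_plane oOmega.
Let fOmega : (mu Omega < +oo)%E := bounded_finite_plane bOmega mOmega.
Local Notation test := (test_function Omega).
Local Notation L2 := (L2 Omega).
Local Notation ip := (L2inner Omega).
Local Notation ipV := (ipL2 Omega).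
Local Notation nrm := (nrm ipV).
Local Notation toL2 := (toL2 Omega).
Let hip : semi_inner ipV := semi_inner_ipL2 mOmega.

(** Integration by parts: [pd i (v * psi)] has integral 0. *)
Lemma weak_grad_test v : test v -> weak_grad Omega v (fun i => pd i v).
Proof.
move=> tv i; split; first exact/test_function_L2/test_function_pd.
move=> psi tpsi; have [[sv _ _] [spsi _ _]] := (tv, tpsi).
apply/eqP; rewrite -addr_eq0; apply/eqP; apply: EFin_inj; rewrite EFinD.
have [Lv Lpsi] := (test_function_L2 oOmega bOmega tv, test_function_L2 oOmega bOmega tpsi).
have Ldv := test_function_L2 oOmega bOmega (test_function_pd i tv).
have Ldpsi := test_function_L2 oOmega bOmega (test_function_pd i tpsi).
rewrite -!L2innerE// -integralD_EFin//; [|exact: L2_mul_integrable..].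
rewrite -[RHS](integral_pd_test oOmega bOmega i (test_functionM tv spsi)).
apply: eq_integral => x _; rewrite pdM// => y; exact: smooth_derivable.
Qed.

Lemma H10_test v : test v -> H10 Omega v.
Proof.
move=> tv; split; first exact: test_function_L2.
exists (fun i => pd i v); first exact: weak_grad_test.
exists (fun=> v); split => // [|i]; apply/L2cvgP => //=.
- by move=> _; exact: test_function_L2.
- exact: test_function_L2.
- by rewrite subrr /nrm (ip0l hip) sqrtr0; exact: cvg_cst.
- by move=> _; exact/test_function_L2/test_function_pd.
- exact/test_function_L2/test_function_pd.
- by rewrite subrr /nrm (ip0l hip) sqrtr0; exact: cvg_cst.
Qed.

(** [l * ip f f] is the Dirichlet form of f at f. *)
Lemma eigenvalue_ge0 l f : L2 f -> 0 < ip f f -> dirichlet_eigenpair Omega l f ->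
  0 <= l.
Proof.
move=> fL f0 [fH _ /(_ f)]; have [_ [g gf _]] := fH.
move=> /(_ _ _ fH gf gf) E; rewrite -(pmulr_lge0 _ f0) -E addr_ge0//;
  by apply: Rintegral_ge0 => x _; rewrite -expr2 sqr_ge0.
Qed.

Lemma pd_sum n (a : 'I_n -> R) (f : 'I_n -> R * R -> R) i :
  (forall k, smooth (f k)) ->
  pd i (fun x => \sum_(k < n) a k * f k x) = (fun x => \sum_(k < n) a k * pd i (f k) x).
Proof.
move=> sf; apply/funext => x.
have h : is_derive x (axis i) (\sum_(k < n) (fun y => a k * f k y))
    (\sum_(k < n) a k * pd i (f k) x).
  apply: is_derive_sum => k; apply: is_derive_mull.
  exact/derivableP/smooth_derivable.
rewrite -(@derive_val _ _ _ _ _ _ _ h); congr (derive _ x (axis i)).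
by apply/funext => y; rewrite fct_sumE.
Qed.

Lemma nrm_le_pointwise (C : R) (u v : L2space R) : 0 <= C ->
  (forall x, Omega x -> `|u x| <= C * `|v x|) -> nrm u <= C * nrm v.
Proof.
move=> C0 uv; rewrite -ler_sqr ?nnegrE ?mulr_ge0 ?nrm_ge0// exprMn !(sqr_nrm hip).
have -> : C ^+ 2 * ipV v v = ipV (C *: v) (C *: v).
  by rewrite (ipZl hip) (ipZr hip) mulrA.
apply: (le_ipL2 mOmega) => x /uv.
rewrite L2spaceZ -!expr2 exprMn.
rewrite -[u x ^+ 2]real_normK ?num_real// -[v x ^+ 2]real_normK ?num_real//.
by rewrite -exprMn ler_sqr ?nnegrE ?mulr_ge0.
Qed.

(** The passage to the limit in [dirichlet_excess_ge0].  There q is the form to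
    be bounded below, r the L^2 error of the approximation by a test function, r1
    and r2 those on the two components of its gradient, and e also the parameter
    of the smooth truncation. *)
Lemma ge0_of_small_errors (q A B g1 g2 : R) :
  0 <= A -> 0 <= B -> 0 <= g1 -> 0 <= g2 ->
  (forall e, 0 < e -> exists r r1 r2, [/\ r < e, 0 <= r1 < e, 0 <= r2 < e &
     - (r1 * (2 * (g1 + r1)) + r2 * (2 * (g2 + r2))) <= q + A * (2 * r + e * B)]) ->
  0 <= q.
Proof.
move=> A0 B0 g10 g20 H; rewrite leNgt; apply/negP => q0.
pose K := 2 * (g1 + 1) + 2 * (g2 + 1) + A * (2 + B).
have AB0 : 0 <= A * (2 + B) by rewrite mulr_ge0// addr_ge0.
have K0 : 0 < K by rewrite /K; lra.
pose e := Num.min 1 (- q / (2 * K)).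
have e0 : 0 < e by rewrite lt_min ltr01/= divr_gt0 ?oppr_gt0 ?mulr_gt0.
have e1 : e <= 1 by rewrite ge_min lexx.
have eK : e * K <= - q / 2.
  apply: (@le_trans _ _ (- q / (2 * K) * K)).
    by rewrite ler_wpM2r ?(ltW K0)// ge_min lexx orbT.
  by rewrite le_eqVlt; apply/orP; left; apply/eqP; field; rewrite gt_eqF.
have [r [r1 [r2 [re /andP[r10 r1e] /andP[r20 r2e]]]]] := H e e0.
have h (g s : R) : 0 <= g -> 0 <= s -> s < e -> s * (2 * (g + s)) <= e * (2 * (g + 1)).
  move=> g0 s0 se; apply: ler_pM => //; [lra|exact: ltW|lra].
have h1 := h _ _ g10 r10 r1e; have h2 := h _ _ g20 r20 r2e.
have h3 : A * (2 * r + e * B) <= A * (2 * e + e * B).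
  by rewrite ler_wpM2l// lerD2r ler_wpM2l// ltW.
have h4 : e * K = e * (2 * (g1 + 1)) + e * (2 * (g2 + 1)) + A * (2 * e + e * B).
  by rewrite /K; ring.
lra.
Qed.

(** The first Beurling-Deny criterion in the form needed below.  Approximate w
    in the norm of [H^1] by test functions psi.  If k is a smooth nondecreasing
    approximation of [excess M] with [k 0 = 0], then k(psi) is a test function
    with gradient [k'(psi) * grad psi], so that
    [<A w, k(psi)> = <grad w, k'(psi) grad psi>
      = <grad psi, k'(psi) grad psi> + <grad w - grad psi, k'(psi) grad psi>],
    where the first term is nonnegative and the second one tends to 0. *)
Lemma dirichlet_excess_ge0 (lam : nat -> R) (phi : nat -> R * R -> R) (M : R) n
    (a : nat -> R) :
  0 <= M -> (forall k, dirichlet_eigenpair Omega (lam k) (phi k)) ->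
  0 <= ipV (\sum_(k < n) (lam k * a k) *: toL2 (phi k))
           (excessL2 Omega M (\sum_(k < n) a k *: toL2 (phi k))).
Proof.
move=> M0 eig.
have Lphi k : L2 (phi k) by have [[]] := eig k.
have [g gP] : {g : nat -> bool -> R * R -> R & forall k,
    weak_grad Omega (phi k) (g k) /\
    exists psi : nat -> R * R -> R, [/\ forall m, test (psi m),
      L2cvg Omega psi (phi k) & forall i, L2cvg Omega (fun m => pd i (psi m)) (g k i)]}.
  apply: (@choice _ _ (fun k (g : bool -> R * R -> R) =>
    weak_grad Omega (phi k) g /\
    exists psi : nat -> R * R -> R, [/\ forall m, test (psi m),
      L2cvg Omega psi (phi k) & forall i, L2cvg Omega (fun m => pd i (psi m)) (g i)])) => k.
  by have [[_ [g hg hpsi]] _ _] := eig k; exists g.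
have [psi psiP] : {psi : nat -> nat -> R * R -> R & forall k,
    [/\ forall m, test (psi k m), L2cvg Omega (psi k) (phi k)
      & forall i, L2cvg Omega (fun m => pd i (psi k m)) (g k i)]}.
  apply: (@choice _ _ (fun k (f : nat -> R * R -> R) => [/\ forall m, test (f m),
    L2cvg Omega f (phi k) & forall i, L2cvg Omega (fun m => pd i (f m)) (g k i)])) => k.
  by have [] := gP k.
have Lg k i : L2 (g k i) by have [/(_ i)[]] := gP k.
pose w := \sum_(k < n) a k *: toL2 (phi k).
pose Aw := \sum_(k < n) (lam k * a k) *: toL2 (phi k).
pose G i := \sum_(k < n) a k *: toL2 (g k i).
pose P m x := \sum_(k < n) a k * psi k m x.
have tpsi k m : test (psi k m) by have [] := psiP k.
have tP m : test (P m) by exact: test_function_sum.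
have LP m : L2 (P m) by exact: test_function_L2.
have LdP i m : L2 (pd i (P m)) by exact/test_function_L2/test_function_pd.
have cvgPw : nrm (toL2 (P m) - w) @[m --> \oo] --> 0.
  apply: (nrm_cvg_eq hip (v := fun m => \sum_(k < n) a k *: toL2 (psi k m))) => [m|].
    apply: (nrm_subr_eq0 mOmega) => x Ox.
    rewrite sum_L2spaceE toL2E//; apply: eq_bigr => k _.
    by rewrite toL2E//; exact: test_function_L2.
  apply: (nrm_sum_cvg hip a) => k; have [_ h _] := psiP k.
  by apply/(L2cvgP mOmega) => // m; exact: test_function_L2.
have cvgdP i : nrm (toL2 (pd i (P m)) - G i) @[m --> \oo] --> 0.
  apply: (nrm_cvg_eq hip (v := fun m => \sum_(k < n) a k *: toL2 (pd i (psi k m)))) => [m|].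
    apply: (nrm_subr_eq0 mOmega) => x Ox.
    rewrite sum_L2spaceE toL2E// pd_sum; last by move=> k; have [] := tpsi k m.
    apply: eq_bigr => k _; rewrite toL2E//.
    exact/test_function_L2/test_function_pd.
  apply: (nrm_sum_cvg hip a) => k; have [_ _ /(_ i) h] := psiP k.
  apply/(L2cvgP mOmega) => // m.
  exact/test_function_L2/test_function_pd.
have formE (v : R * R -> R) : test v ->
    ipV Aw (toL2 v) = \sum_(i : bool) ipV (G i) (toL2 (pd i v)).
  move=> tv; rewrite (ip_suml hip) big_bool !(ip_suml hip) -big_split/=.
  apply: eq_bigr => k _; rewrite !(ipZl hip) !ipL2_toL2//; last 3 first.
  - exact/test_function_L2/test_function_pd.
  - exact/test_function_L2/test_function_pd.
  - exact: test_function_L2.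
  have [gk _] := gP k; have [_ _ /(_ v (g k) (fun i => pd i v))] := eig k.
  move=> /(_ (H10_test tv) gk (weak_grad_test tv)) E.
  transitivity (a k * (lam k * ip (phi k) v)); first by rewrite mulrA (mulrC (a k)).
  by rewrite -E mulrDr; exact: addrC.
have lower m d : 0 < d ->
    - \sum_(i : bool) nrm (toL2 (pd i (P m)) - G i) *
       (2 * (nrm (G i) + nrm (toL2 (pd i (P m)) - G i)))
    <= ipV Aw (toL2 (fun x => regexcess d M (P m x))).
  move=> d0; have tv := test_function_regexcess M d0 (tP m).
  rewrite formE// -sumrN; apply: ler_sum => i _.
  have sP : smooth (P m) by have [] := tP m.
  have LE : L2 (pd i (fun x => regexcess d M (P m x))).
    exact/test_function_L2/test_function_pd.
  set D := toL2 (pd i (P m)); set E := toL2 (pd i _).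
  have EE x : Omega x -> E x = dregexcess d M (P m x) * D x.
    by move=> Ox; rewrite !toL2E// pd_regexcess.
  have DE : 0 <= ipV D E.
    apply: ipL2_ge0 => x Ox; rewrite EE// mulrCA -expr2 mulr_ge0 ?sqr_ge0//.
    by have /andP[] := dregexcess_bounds M (P m x) d0.
  have nE : nrm E <= 2 * nrm D.
    apply: nrm_le_pointwise => // x Ox; rewrite EE// normrM ler_wpM2r//.
    by have /andP[h1 h2] := dregexcess_bounds M (P m x) d0; rewrite ger0_norm.
  have h1 := le_trans (ler_norm _) (ip_le_nrm hip (D - G i) E).
  have h2 : nrm D <= nrm (G i) + nrm (D - G i).
    by have := ler_nrmD hip (G i) (D - G i); rewrite addrC subrK.
  have h3 := ler_wpM2l (nrm_ge0 ipV (D - G i)) (le_trans nE (ler_wpM2l (ler0n _ 2) h2)).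
  have -> : ipV (G i) E = ipV D E - ipV (D - G i) E by rewrite (ipBl hip) subKr.
  by apply: le_trans (lerB DE h1); rewrite sub0r lerN2.
have upper m d : 0 < d ->
    nrm (toL2 (fun x => regexcess d M (P m x)) - excessL2 Omega M w) <=
    2 * nrm (toL2 (P m) - w) + d * nrm (toL2 (cst 1)).
  move=> d0; have tv := test_function_regexcess M d0 (tP m).
  have L1 : L2 (cst 1).
    by apply: (L2_bounded mOmega fOmega (B := 1)) => // x _; rewrite normr1.
  pose z := toL2 (P m) - w.
  have Lz : L2 (fun x => `|z x|).
    have [mz _] := proj1 (L2P mOmega z) (L2space_L2 mOmega z).
    apply: (L2_le mOmega (C := 1) (f := z)); last exact: L2space_L2.
      exact: measurableT_comp.
    by move=> x _; rewrite normr_id mul1r.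
  pose b := 2 *: toL2 (fun x => `|z x|) + d *: toL2 (cst 1).
  apply: (@le_trans _ _ (nrm b)).
    rewrite -[X in _ <= X]mul1r; apply: nrm_le_pointwise => // x Ox; rewrite mul1r.
    have -> : b x = 2 * `|P m x - w x| + d.
      by rewrite /b L2spaceD !L2spaceZ !toL2E// mulr1 /z L2spaceB toL2E.
    rewrite L2spaceB toL2E ?excessL2E//; last exact: test_function_L2.
    rewrite [X in _ <= X]ger0_norm; last by rewrite addr_ge0 ?mulr_ge0// ltW.
    apply: (le_trans (ler_distD (regexcess d M (w x)) _ _)).
    by apply: lerD; [exact: regexcess_lip|exact: regexcess_approx].
  apply: (le_trans (ler_nrmD hip _ _)); rewrite !(nrmZ hip) normr_nat gtr0_norm//.
  rewrite lerD2r ler_wpM2l// -[X in _ <= X]mul1r; apply: nrm_le_pointwise => // x Ox.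
  by rewrite toL2E// normr_id mul1r.
apply: (@ge0_of_small_errors _ (nrm Aw) (nrm (toL2 (cst 1)))
  (nrm (G true)) (nrm (G false))); [exact: nrm_ge0..|] => e e0.
have near_w := cvgr_lt 0 cvgPw e e0.
have near_G i := cvgr_lt 0 (cvgdP i) e e0.
have [m [mw [mGt mGf]]] :=
  filter_ex (filterI (near_w _) (filterI (near_G _ true) (near_G _ false))).
exists (nrm (toL2 (P m) - w)), (nrm (toL2 (pd true (P m)) - G true)),
  (nrm (toL2 (pd false (P m)) - G false)).
split; [exact: mw|by rewrite nrm_ge0; exact: mGt|by rewrite nrm_ge0; exact: mGf|].
have := lower m e e0; rewrite big_bool/= => /le_trans; apply.
rewrite -[ipV Aw (toL2 _)](subrK (ipV Aw (excessL2 Omega M w))) addrC lerD2l -(ipBr hip).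
apply: (le_trans (ler_norm _)); apply: (le_trans (ip_le_nrm hip _ _)).
exact: ler_wpM2l (nrm_ge0 _ _) _ _ (upper m e e0).
Qed.

End DirichletForm.

(** * Expansions in an orthonormal basis *)

Section Expansions.
Context (R : realType) (Omega : set (R * R)).
Local Notation T2 := (measurableTypeR R * measurableTypeR R)%type.
Hypothesis mOmega : measurable (Omega : set T2).
Local Notation L2 := (L2 Omega).
Local Notation ip := (L2inner Omega).
Local Notation ipV := (ipL2 Omega).
Local Notation nrm := (nrm ipV).
Local Notation toL2 := (toL2 Omega).
Let hip : semi_inner ipV := semi_inner_ipL2 mOmega.
Variable phi : nat -> R * R -> R.
Hypothesis hphi : orthonormal_basis Omega phi.
Let Phi k : L2space R := toL2 (phi k).

Lemma basis_L2 k : L2 (phi k). Proof. by have [] := hphi. Qed.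

Lemma orthonormal_toL2 j k : ipV (Phi j) (Phi k) = (j == k)%:R.
Proof. by rewrite ipL2_toL2//; [have [_ ->] := hphi|exact: basis_L2..]. Qed.

Lemma nrm_basis k : nrm (Phi k) = 1.
Proof. by rewrite /nrm orthonormal_toL2 eqxx sqrtr1. Qed.

Lemma norm_ip_basis_le (v : L2space R) k : `|ipV v (Phi k)| <= nrm v.
Proof.
by have := ip_le_nrm hip v (Phi k); rewrite nrm_basis mulr1.
Qed.

Lemma L2_sum n (f : 'I_n -> R * R -> R) : (forall k, L2 (f k)) ->
  L2 (fun x => \sum_(k < n) f k x).
Proof.
elim: n f => [|n IH] f fL.
  rewrite (_ : (fun x => _) = (0 : L2space R)); first exact: L2space_L2.
  by apply/funext => x; rewrite big_ord0.
under eq_fun do rewrite big_ord_recr /=.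
by apply: L2D => //; exact: IH.
Qed.

Lemma basis_complete (v : L2space R) :
  nrm (v - partial_sum ipV Phi n v) @[n --> \oo] --> 0.
Proof.
have [_ _ /(_ v (L2space_L2 mOmega v))] := hphi.
have LS n : L2 (fun x => \sum_(k < n) ip v (phi k) * phi k x).
  by apply: L2_sum => k; exact/L2Z/basis_L2.
move=> /(L2cvgP mOmega LS (L2space_L2 mOmega v)).
rewrite (_ : (fun n => _) = fun n => nrm (v - partial_sum ipV Phi n v))//.
apply/funext => n; rewrite (nrmB hip); apply: eq_nrm_L2 => x Ox.
rewrite !L2spaceB !toL2E//; last exact: L2space_L2.
rewrite sum_L2spaceE; congr (_ - _); apply: eq_bigr => k _.
rewrite toL2E//; last exact: basis_L2.
congr (_ * _); transitivity (ipV (toL2 v) (Phi k)).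
  by rewrite ipL2_toL2//; [exact: L2space_L2|exact: basis_L2].
by apply: eq_ipL2 => // y Oy; rewrite toL2E//; exact: L2space_L2.
Qed.

(** Taking the k-th coefficient is continuous on L^2, and it is constant on the
    partial sums with more than k terms. *)
Lemma diag_op_coef m f g k : L2 f -> diag_op Omega phi m f g ->
  ip g (phi k) = m k * ip f (phi k).
Proof.
move=> fL [gL]; have Lphi := basis_L2.
have LS n : L2 (fun x => \sum_(k < n) m k * ip f (phi k) * phi k x).
  by apply: L2_sum => j; exact/L2Z.
move=> /(L2cvgP mOmega LS gL) h.
apply/eqP; rewrite -subr_eq0 -normr_le0; apply/ler_addgt0Pr => e e0; rewrite add0r.
near \oo => n.
have kn : (k < n)%N by near: n; exact: nbhs_infty_gt.
pose S n x := \sum_(k < n) m k * ip f (phi k) * phi k x.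
have hn : nrm (toL2 (S n) - toL2 g) < e by near: n; exact: (cvgr_lt 0 h).
have Sk : ip (S n) (phi k) = m k * ip f (phi k).
  have LSn : L2 (S n) by exact: LS.
  transitivity (ipV (\sum_(j < n) (m j * ip f (phi j)) *: Phi j) (Phi (Ordinal kn)));
    last exact: (ip_sum_phi hip orthonormal_toL2).
  rewrite -ipL2_toL2//; apply: eq_ipL2 => // x Ox; rewrite toL2E// sum_L2spaceE.
  by apply: eq_bigr => j _; rewrite toL2E.
rewrite distrC -Sk; apply: le_trans (ltW hn); apply: le_trans (norm_ip_basis_le _ k).
by rewrite (ipBl hip) !ipL2_toL2//; exact: LS.
Unshelve. all: by end_near. Qed.

(** Mean value points of an antiderivative are tags for which the Riemann sums
    of the coefficients are exact. *)
Lemma L2_integral_coef (F : R -> R * R -> R) (t : R) (I : R * R -> R) k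
    (G g : R -> R) : 0 <= t ->
  is_L2_integral Omega F 0 t I -> (forall s, 0 <= s <= t -> L2 (F s)) ->
  (forall s, 0 <= s <= t -> ip (F s) (phi k) = g s) ->
  (forall s : R, is_derive s 1 G (g s)) ->
  ip I (phi k) = G t - G 0.
Proof.
move=> t0 [IL HI] LF Fg dG.
apply/eqP; rewrite -subr_eq0 -normr_le0; apply/ler_addgt0Pr => e e0; rewrite add0r.
have [d d0 Hd] := HI e e0.
(* n equal steps, with n > t / d so that the mesh t / n is less than d *)
pose n := (Num.truncn (t / d)).+1.
have n0 : 0 < n%:R :> R by rewrite ltr0n.
have tn : t / n%:R < d.
  by rewrite ltr_pdivrMr// mulrC -ltr_pdivrMr// truncnS_gt.
pose tau (i : nat) := i%:R * (t / n%:R).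
have tauS i : tau i.+1 - tau i = t / n%:R by rewrite /tau -natr1; ring.
have tn0 : 0 <= t / n%:R by rewrite divr_ge0// ltW.
have tau_le i : tau i <= tau i.+1 by rewrite -subr_ge0 tauS.
have [xi xiP] : {xi : nat -> R & forall i, tau i <= xi i <= tau i.+1 /\
    G (tau i.+1) - G (tau i) = g (xi i) * (tau i.+1 - tau i)}.
  apply: (@choice _ _ (fun i x => tau i <= x <= tau i.+1 /\
    G (tau i.+1) - G (tau i) = g x * (tau i.+1 - tau i))) => i.
  have [|x] := @MVT_segment _ G g _ _ (tau_le i).
    by apply: derivable_within_continuous => z _; case: (dG z).
  by rewrite in_itv; exists x.
have tau0 : tau 0%N = 0 by rewrite /tau mul0r.
have taun : tau n = t by rewrite /tau mulrC divfK// gt_eqF.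
have := Hd n tau xi tau0 taun.
have xi_itv (i : 'I_n) : 0 <= xi i <= t.
  have [/andP[h1 h2] _] := xiP i; rewrite (le_trans _ h1) ?mulr_ge0//=.
  rewrite (le_trans h2)// -taun ler_wpM2r// ler_nat; exact: ltn_ord.
have LFx (i : 'I_n) : L2 (F (xi i)) by exact/LF/xi_itv.
pose S x := \sum_(i < n) (tau i.+1 - tau i) * F (xi i) x.
have LS : L2 S by apply: L2_sum => i; exact: L2Z.
rewrite L2norm_nrm//; last exact: L2B.
rewrite lte_fin nrm_toL2B// -/S => h.
have {h} /ltW h : nrm (toL2 S - toL2 I) < e.
  apply: h => i _; have [? _] := xiP i; split => //; by rewrite tauS.
have Lphi := basis_L2.
have SG : ip S (phi k) = G t - G 0.
  rewrite -ipL2_toL2//; transitivity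
    (ipV (\sum_(i < n) (tau i.+1 - tau i) *: toL2 (F (xi i))) (Phi k)).
    apply: eq_ipL2 => // x Ox; rewrite toL2E// sum_L2spaceE.
    by apply: eq_bigr => i _; rewrite toL2E.
  rewrite (ip_suml hip) -[in RHS]taun -[in RHS]tau0 -(telescope_sumr (G \o tau))// big_mkord.
  apply: eq_bigr => i _; rewrite (ipZl hip) ipL2_toL2// Fg//=.
  by have [_ ->] := xiP i; rewrite mulrC.
rewrite -SG distrC; apply: le_trans h; apply: le_trans (norm_ip_basis_le _ k).
by rewrite (ipBl hip) !ipL2_toL2.
Qed.

End Expansions.

(** * Continuous paths of functions *)

Section Paths.
Context (R : realType) (Omega : set (R * R)).
Local Notation T2 := (measurableTypeR R * measurableTypeR R)%type.
Local Notation mu := (mu2 R).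
Hypothesis oOmega : open Omega.
Hypothesis bOmega : bounded_set Omega.
Let mOmega : measurable (Omega : set T2) := open_measurable_plane oOmega.
Let fOmega : (mu Omega < +oo)%E := bounded_finite_plane bOmega mOmega.
Local Notation L2 := (L2 Omega).
Local Notation ipV := (ipL2 Omega).
Local Notation nrm := (nrm ipV).
Local Notation toL2 := (toL2 Omega).
Let hip : semi_inner ipV := semi_inner_ipL2 mOmega.

Lemma compact_closure_plane : compact (closure Omega).
Proof.
have [M [_ /(_ (`|M| + 1))]] := bOmega.
rewrite (le_lt_trans (ler_norm M)) ?ltrDl// => /(_ isT) h.
pose r := `|M| + 1.
pose K := `[- r, r]%classic `*` `[- r, r]%classic.
have cK : compact K by apply: compact_setX; exact: segment_compact.
apply: (subclosed_compact _ cK); first exact: closed_closure.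
have -> : K = closure K.
  apply/closure_id; apply: compact_closed cK; exact: norm_hausdorff.
apply: closureS => x /h /=; rewrite [X in X <= _ -> _]/Num.norm/= ge_max.
by move=> /andP[]; rewrite !ler_norml /K /= !in_itv.
Qed.

Lemma C0_bounded f : C0 Omega f ->
  exists B, forall x, closure Omega x -> `|f x| <= B.
Proof.
move=> [cf _]; have := continuous_compact cf compact_closure_plane.
move=> /compact_bounded[M [_ /(_ (`|M| + 1))]].
rewrite (le_lt_trans (ler_norm M)) ?ltrDl// => /(_ isT) h.
by exists (`|M| + 1) => x Ox; apply: h; exists x.
Qed.

Lemma C0_measurable f : C0 Omega f -> measurable_fun Omega (f : T2 -> R).
Proof.
move=> [cf _]; apply: continuous_measurable_plane => //.
apply: continuous_subspaceW cf; exact: subset_closure.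
Qed.

Lemma C0_comp_L2 (N : R -> R) f : continuous N -> C0 Omega f -> L2 (N \o f).
Proof.
move=> cN hf; have [B fB] := C0_bounded hf.
have : compact (N @` `[- B, B]%classic).
  apply: continuous_compact; last exact: segment_compact.
  exact: continuous_subspaceT.
move=> /compact_bounded[M [_ /(_ (`|M| + 1))]].
rewrite (le_lt_trans (ler_norm M)) ?ltrDl// => /(_ isT) h.
apply: (L2_bounded mOmega fOmega (B := `|M| + 1)).
  apply: measurableT_comp; last exact: C0_measurable.
  exact: continuous_measurable_fun.
move=> x Ox; apply: h; exists (f x) => //=; rewrite in_itv/= -ler_norml.
by apply: fB; exact: subset_closure.
Qed.

Lemma C0_L2 f : C0 Omega f -> L2 f.
Proof. by move=> hf; apply: (C0_comp_L2 (N := id)) => // x; exact: cvg_id. Qed.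

Lemma nrm_le_const (u : L2space R) (e : R) : 0 <= e ->
  (forall x, Omega x -> `|u x| <= e) -> nrm u <= e * nrm (toL2 (cst 1)).
Proof.
move=> e0 ue; apply: (nrm_le_pointwise oOmega) => // x Ox; rewrite toL2E//.
  by rewrite normr1 mulr1; exact: ue.
by apply: (L2_bounded mOmega fOmega (B := 1)) => // y _; rewrite normr1.
Qed.

(** Composing with [clip T] extends a path on [0, T] to the real line, so that
    the endpoints need no separate treatment. *)
Lemma continuous_in_C0_near (T : R) (u : R -> R * R -> R) (t e : R) :
  0 <= T -> continuous_in_C0 Omega T u -> 0 < e ->
  \forall s \near t, forall x, closure Omega x ->
    `|u (clip T s) x - u (clip T t) x| < e.
Proof.
move=> T0 [_ /subspace_continuousP cu] e0.
have ct : `[0, T]%classic (clip T t) by rewrite /= in_itv/=; exact: clip_itv.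
have : nbhs (u (clip T t) : {uniform` closure Omega -> R})
    [set h | forall x, closure Omega x -> `|h x - u (clip T t) x| < e].
  apply/uniform_nbhs; exists [set xy | ball xy.1 e xy.2]; split.
    exact: (entourage_ball _ (PosNum e0)).
  by move=> h hE x Ox /=; rewrite distrC; exact: hE.
move=> /(cu _ ct) H.
have cc : clip T s @[s --> t] --> clip T t.
  apply/cvgrPdist_lt => d d0; near=> s; apply: (le_lt_trans (clip_lip _ _ T0)).
  near: s; exact: (@cvgr_dist_lt _ _ _ _ _ id t).
have Hn : \forall s \near t, `[0, T]%classic (clip T s) ->
    forall x, closure Omega x -> `|u (clip T s) x - u (clip T t) x| < e.
  exact: (cc _ H).
near=> s; have hs : `[0, T]%classic (clip T s) ->
    forall x, closure Omega x -> `|u (clip T s) x - u (clip T t) x| < e.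
  by near: s; exact: Hn.
by apply: hs; rewrite /= in_itv/=; exact: clip_itv.
Unshelve. all: by end_near. Qed.

(** For s near t the functions [u (clip T s)] take values in a common bounded
    interval, on which N is Lipschitz, so N preserves uniform convergence; on a
    bounded domain this implies convergence in L^2. *)
Lemma locally_uniform_path_cvg (N : R -> R) (T : R) (u : R -> R * R -> R) (t : R) :
  (forall B, exists C, forall y z, `|y| <= B -> `|z| <= B ->
     `|N y - N z| <= C * `|y - z|) -> continuous N ->
  0 <= T -> continuous_in_C0 Omega T u ->
  nrm (toL2 (N \o u (clip T s)) - toL2 (N \o u (clip T t))) @[s --> t] --> 0.
Proof.
move=> NC cN T0 hu.
have hC s : C0 Omega (u (clip T s)) by apply: hu.1; exact: clip_itv.
have [B uB] := C0_bounded (hC t).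
have [C HC] := NC (`|B| + 1).
pose K := `|C| * nrm (toL2 (cst 1)) + 1.
have K0 : 0 < K by rewrite ltr_wpDl// mulr_ge0// nrm_ge0.
apply/cvgr0Pnorm_lt => e e0.
pose d := Num.min 1 (e / (2 * K)).
have d0 : 0 < d by rewrite lt_min ltr01 divr_gt0// mulr_gt0.
near=> s.
have hs : forall x, closure Omega x -> `|u (clip T s) x - u (clip T t) x| < d.
  by near: s; exact: (continuous_in_C0_near t T0 hu d0).
rewrite ger0_norm ?nrm_ge0//.
apply: (@le_lt_trans _ _ (`|C| * d * nrm (toL2 (cst 1)))).
  apply: nrm_le_const => [|x Ox]; first by rewrite mulr_ge0// ltW.
  rewrite L2spaceB !toL2E//; [|exact: C0_comp_L2..].
  have hx := hs x (subset_closure Ox).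
  have bx := uB x (subset_closure Ox).
  apply: (@le_trans _ _ (C * `|u (clip T s) x - u (clip T t) x|)).
    apply: HC; last by rewrite (le_trans bx)// (le_trans (ler_norm B))// lerDl.
    have : `|u (clip T s) x| <= `|u (clip T s) x - u (clip T t) x| + `|u (clip T t) x|.
      by have := ler_normD (u (clip T s) x - u (clip T t) x) (u (clip T t) x);
        rewrite subrK.
    have : d <= 1 by rewrite ge_min lexx.
    by have := ler_norm B; lra.
  apply: (@le_trans _ _ (`|C| * `|u (clip T s) x - u (clip T t) x|)).
    by rewrite ler_wpM2r// ler_norm.
  by rewrite ler_wpM2l// ltW.
apply: (@le_lt_trans _ _ (K * d)).
  rewrite mulrAC ler_wpM2r ?(ltW d0)// lerDl//.
have : d <= e / (2 * K) by rewrite ge_min lexx orbT.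
move=> /(ler_wpM2l (ltW K0)) /le_lt_trans; apply.
rewrite (_ : K * _ = e / 2); last by field; rewrite gt_eqF.
by rewrite ltr_pdivrMr// ltr_pMr// ltr1n.
Unshelve. all: by end_near. Qed.

(** A continuous function whose excess vanishes almost everywhere takes its
    values in [0, M]: otherwise the excess is bounded away from 0 on a ball, and
    balls have positive measure. *)
Lemma nrm_excess_eq0 (M : R) (f : R * R -> R) x : 0 <= M ->
  C0 Omega f -> nrm (excessL2 Omega M (toL2 f)) = 0 -> Omega x -> 0 <= f x <= M.
Proof.
move=> M0 hf nf0 Ox; suff : excess M (f x) = 0.
  by case: (excessP (f x) M0); lra.
apply/eqP; apply: contraT => fx0.
pose eta := `|excess M (f x)| / 2.
have eta0 : 0 < eta by rewrite divr_gt0// normr_gt0.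
have cf : {for x, continuous f}.
  have := continuous_subspaceW (@subset_closure _ Omega) hf.1.
  by rewrite continuous_open_subspace// => /(_ x); apply; rewrite inE.
(* excess M is 1-Lipschitz, so near x the excess of f keeps half of its size *)
have : nbhs x (Omega `&` [set y | `|f x - f y| < eta]).
  apply: filterI; first exact: open_nbhs_nbhs.
  by move/cvgrPdist_lt : cf; exact.
move=> /nbhs_ballP[r /= r0 rP].
pose D : set (R * R) := ball x r.
have mD : measurable (D : set T2) by apply: open_measurable_plane; exact: ball_open.
have LD : L2 \1_D.
  apply: (L2_bounded mOmega fOmega (B := 1)).
    by apply: measurable_funTS; exact: measurable_indic.
  by move=> y _; rewrite indicE; case: (_ \in _); rewrite ?normr1 ?normr0.
have fL := C0_L2 hf.
have h : nrm (toL2 \1_D) <= eta^-1 * nrm (excessL2 Omega M (toL2 f)).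
  apply: (nrm_le_pointwise oOmega) => [|y Oy]; first by rewrite invr_ge0 ltW.
  rewrite toL2E// excessL2E// toL2E// ler_pdivlMl//.
  rewrite indicE; case: (boolP (y \in D)) => [|_]; last by rewrite normr0 mulr0.
  rewrite inE => /rP[_ /=] fxy; rewrite normr1 mulr1.
  have h1 := le_lt_trans (excess_lip (f x) (f y) M0) fxy.
  have h2 := lerB_dist (excess M (f x)) (excess M (f y)).
  by rewrite /eta in h1 *; lra.
rewrite nf0 mulr0 in h.
have h0 : ipV (toL2 \1_D) (toL2 \1_D) = 0.
  by rewrite -(sqr_nrm hip); have := nrm_ge0 ipV (toL2 \1_D); nra.
have : (0 < mu D)%E := mu2_ball_gt0 x r0.
suff -> : mu D = (ipV (toL2 \1_D) (toL2 \1_D))%:E by rewrite h0 ltxx.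
rewrite ipL2_toL2// -(L2innerE mOmega)//.
have -> : mu D = mu (D `&` Omega) by congr (mu _); rewrite setIidl// => y /rP[].
rewrite -integral_indic//; apply: eq_integral => y _.
by rewrite indicE; case: (_ \in _); rewrite ?mulr1 ?mulr0.
Qed.

End Paths.

(** * The reaction term *)

Section Nonlinearity.
Context (R : realType).
Variables u_minus u_m u_plus : R.
Local Notation N := (nonlinearity u_minus u_m u_plus).

Lemma continuous_nonlinearity : continuous N.
Proof.
move=> v; rewrite /nonlinearity; apply: cvgM; first apply: cvgM.
- exact: cvg_id.
- apply: cvgB; [apply: cvgD; [exact: cvg_id|exact: cvg_cst]|exact: cvg_cst].
- apply: cvgB; [apply: cvgD; [exact: cvg_id|exact: cvg_cst]|exact: cvg_cst].
Qed.

Lemma nonlinearity_locally_lipschitz (B : R) : exists C, forall y z,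
  `|y| <= B -> `|z| <= B -> `|N y - N z| <= C * `|y - z|.
Proof.
pose p := u_minus - u_m; pose q := u_minus - u_plus.
exists (3 * B ^+ 2 + 2 * `|p + q| * B + `|p * q|) => y z yB zB.
have -> : N y - N z =
    (y ^+ 2 + y * z + z ^+ 2 + (p + q) * (y + z) + p * q) * (y - z).
  by rewrite /nonlinearity /p /q; ring.
have B0 : 0 <= B := le_trans (normr_ge0 y) yB.
rewrite normrM ler_wpM2r// (le_trans (ler_normD _ _))// lerD2r.
rewrite (le_trans (ler_normD _ _))// lerD//; last first.
  rewrite normrM [2 * _]mulrC -mulrA ler_wpM2l//.
  by rewrite (le_trans (ler_normD _ _))//; lra.
have yz a b : `|a| <= B -> `|b| <= B -> `|a * b| <= B ^+ 2.
  by move=> aB bB; rewrite normrM expr2 ler_pM.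
rewrite !expr2 in yz *.
rewrite (le_trans (ler_normD _ _))//.
have h1 := le_trans (ler_normD (y * y) (y * z)) (lerD (yz _ _ yB yB) (yz _ _ yB zB)).
by have := yz _ _ zB zB; lra.
Qed.

(** With M = u_plus - u_minus, the roots of the cubic are 0, u_m - u_minus and M,
    in increasing order.  Hence it is negative below 0 and positive above M. *)
Lemma nonlinearity_excess_ge0 (v : R) : u_minus < u_m < u_plus ->
  0 <= N v * excess (u_plus - u_minus) v.
Proof.
move=> /andP[h1 h2]; have M0 : 0 <= u_plus - u_minus by lra.
rewrite /nonlinearity; case: (excessP v M0) => [v0|v0 vM|vM].
- have -> : v * (v + u_minus - u_m) * (v + u_minus - u_plus) * v =
    v ^+ 2 * ((u_m - u_minus - v) * (u_plus - u_minus - v)) by ring.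
  by apply: mulr_ge0; [exact: sqr_ge0|apply: mulr_ge0; lra].
- by rewrite mulr0.
- have -> : v * (v + u_minus - u_m) * (v + u_minus - u_plus) * (v - (u_plus - u_minus)) =
    (v - (u_plus - u_minus)) ^+ 2 * (v * (v + u_minus - u_m)) by ring.
  by apply: mulr_ge0; [exact: sqr_ge0|apply: mulr_ge0; lra].
Qed.

End Nonlinearity.

(** * Invariance along mild solutions *)

Section MildSolution.
Context (R : realType) (Omega : set (R * R)).
Local Notation T2 := (measurableTypeR R * measurableTypeR R)%type.
Local Notation mu := (mu2 R).
Hypothesis oOmega : open Omega.
Hypothesis bOmega : bounded_set Omega.
Let mOmega : measurable (Omega : set T2) := open_measurable_plane oOmega.
Local Notation L2 := (L2 Omega).
Local Notation ip := (L2inner Omega).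
Local Notation ipV := (ipL2 Omega).
Local Notation nrm := (nrm ipV).
Local Notation toL2 := (toL2 Omega).
Let hip : semi_inner ipV := semi_inner_ipL2 mOmega.

Lemma ae_eq_L2inner f g h : {ae mu, forall x, Omega x -> f x = g x} ->
  L2 f -> L2 g -> L2 h -> ip f h = ip g h.
Proof.
move=> fg fL gL hL; apply: EFin_inj; rewrite -!(L2innerE mOmega)//.
have mL v : L2 v -> measurable_fun Omega (fun x : T2 => (v x * h x)%:E).
  move=> vL; apply/measurable_EFinP; apply: measurable_funM.
    by have [] := proj1 (L2P mOmega v) vL.
  by have [] := proj1 (L2P mOmega h) hL.
apply: ae_eq_integral => //; [exact: mL|exact: mL|].
by apply: (@filterS _ _ (ae_filter_ringOfSetsType mu) _ _ _ fg) => x fgx Ox; rewrite fgx.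
Qed.

Variables (lam : nat -> R) (phi : nat -> R * R -> R) (alpha eps T : R) (N : R -> R).
Variables (u0 : R * R -> R) (u : R -> R * R -> R).
Hypothesis hphi : orthonormal_basis Omega phi.
Hypothesis T0 : 0 < T.
Hypothesis hu0 : C0 Omega u0.
Hypothesis hu : mild_solution Omega lam phi alpha eps T N u0 u.
Hypothesis cN : continuous N.
Hypothesis lN : forall B, exists C, forall y z, `|y| <= B -> `|z| <= B ->
  `|N y - N z| <= C * `|y - z|.

Let U t : L2space R := toL2 (u (clip T t)).
Let W t : L2space R := toL2 (N \o u (clip T t)).
Let Phi k : L2space R := toL2 (phi k).
Let m k := eps ^+ 2 * lam k `^ alpha.

Let C0u t : C0 Omega (u (clip T t)).
Proof. by apply: hu.1.1; apply: clip_itv; exact: ltW. Qed.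

Lemma cvg_path t : nrm (U s - U t) @[s --> t] --> 0.
Proof.
apply: (locally_uniform_path_cvg oOmega bOmega (N := id)) hu.1 => //; last exact: ltW.
- by move=> B; exists 1 => y z _ _; rewrite mul1r.
- by move=> x; exact: cvg_id.
Qed.

Lemma cvg_path_reaction t : nrm (W s - W t) @[s --> t] --> 0.
Proof.
by apply: (locally_uniform_path_cvg oOmega bOmega) hu.1 => //; exact: ltW.
Qed.

Lemma continuous_reaction_coef k : continuous (fun t => ipV (W t) (Phi k)).
Proof.
move=> t; apply/cvgrPdist_lt => e e0; near=> s.
rewrite -(ipBl hip); apply: (le_lt_trans (norm_ip_basis_le mOmega hphi _ k)).
rewrite (nrmB hip); near: s; exact: (cvgr_lt 0 (@cvg_path_reaction t) e e0).
Unshelve. all: by end_near. Qed.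

(** On the k-th coefficient the Duhamel formula is the variation of constants
    formula for a scalar linear equation.  Its integral is expressed by an
    antiderivative H of [expR (m k * t) * ipV (W t) (Phi k)]; as U and W are
    extended by their values at 0 and T, the equation makes sense on the line.
    The last conjunct identifies the initial value. *)
Lemma mild_solution_coef k : exists c : R -> R,
  (forall t : R, is_derive t 1 c (- (m k * c t) - ipV (W t) (Phi k))) /\
  (forall t, 0 <= t <= T -> c t = ipV (U t) (Phi k)) /\ c 0 = ip u0 (phi k).
Proof.
have [H dH] : exists H : R -> R, forall t : R,
    is_derive t 1 H (expR (m k * t) * ipV (W t) (Phi k)).
  apply: continuous_antiderivative => t; apply: cvgM; last exact: continuous_reaction_coef.
  apply: continuous_comp; last exact: continuous_expR.
  by apply: cvgM; [exact: cvg_cst|exact: cvg_id].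
pose c t := expR (- (m k * t)) * (ip u0 (phi k) - (H t - H 0)).
have Lphi := basis_L2 hphi.
exists c; split; [|split].
- move=> t.
  have dl : is_derive t 1 (fun s : R => - (m k * s)) (- m k).
    apply: is_deriveN; rewrite -[X in is_derive _ _ _ X]mulr1.
    exact: is_derive_mull.
  have de := @is_derive1_comp R expR _ t _ _ (is_derive_expR _) dl.
  have dH0 : is_derive t 1 (fun s => ip u0 (phi k) - (H s - H 0))
      (0 - (expR (m k * t) * ipV (W t) (Phi k) - 0)).
    apply: is_deriveB; apply: is_deriveB.
  have := is_deriveM de dH0.
  rewrite (_ : _ + _ = - (m k * c t) - ipV (W t) (Phi k))//.
  have E1 : expR (- (m k * t)) * expR (m k * t) = 1 by rewrite -expRD addNr expR0.
  rewrite /GRing.scale/= /c.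
  transitivity (- (m k * (expR (- (m k * t)) * (ip u0 (phi k) - (H t - H 0)))) -
    expR (- (m k * t)) * expR (m k * t) * ipV (W t) (Phi k)); first by ring.
  by rewrite E1 mul1r.
- move=> t tT; have /andP[t0 tleT] := tT.
  have [q [F [I [hq hF hI huE]]]] := hu.2 t tT.
  have Lu0 := C0_L2 oOmega bOmega hu0.
  have ct : clip T t = t by exact: clip_id.
  have Lu s : L2 (u (clip T s)) by exact: C0_L2.
  have LNu s : L2 (N \o u (clip T s)) by exact: C0_comp_L2.
  have qE := diag_op_coef mOmega hphi k Lu0 hq.
  have IE : ip I (phi k) = expR (- (m k * t)) * H t - expR (- (m k * t)) * H 0.
    apply: (L2_integral_coef mOmega hphi t0 hI
      (G := fun s => expR (- (m k * t)) * H s)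
      (g := fun s => expR (- (m k * t)) * (expR (m k * s) * ipV (W s) (Phi k)))).
    + by move=> s st; have [] := hF s st.
    + move=> s st; have sT : clip T s = s.
        by apply: clip_id; move: st => /andP[-> st]; exact: le_trans tleT.
      have LNs : L2 (N \o u s) by have := LNu s; rewrite sT.
      rewrite (diag_op_coef mOmega hphi k LNs (hF s st)) ipL2_toL2//.
      rewrite sT [RHS]mulrA -expRD; congr (expR _ * _).
      by rewrite /m /frac_eigenvalue; ring.
  have [Lq LI] : L2 q /\ L2 I by split; [exact: hq.1|exact: hI.1].
  rewrite /U ct ipL2_toL2//; last by have := Lu t; rewrite ct.
  rewrite (ae_eq_L2inner huE) //; [|by have := Lu t; rewrite ct|exact: L2B].
  transitivity (ip q (phi k) - ip I (phi k)).
    by rewrite qE IE /c /m /frac_eigenvalue; ring.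
  rewrite -!ipL2_toL2//; last exact: L2B.
  rewrite -(ipBl hip); apply: eq_ipL2 => // x Ox.
  by rewrite L2spaceB !toL2E//; exact: L2B.
- by rewrite /c mulr0 oppr0 expR0 mul1r subrr subr0.
Qed.

Hypothesis hlam : forall k, dirichlet_eigenpair Omega (lam k) (phi k).
Hypothesis halpha : 0 < alpha < 1.

(** The energy estimate keeps the distance of U t to the set of functions with
    values in [0, M] at its initial value, which is 0: [U 0] and [u0] have the same
    coefficients, hence are at distance 0 from each other. *)
Lemma mild_solution_invariant (M t : R) : 0 <= M ->
  (forall v, 0 <= N v * excess M v) ->
  (forall x, Omega x -> 0 <= u0 x <= M) ->
  0 <= t <= T -> nrm (excessL2 Omega M (U t)) = 0.
Proof.
move=> M0 signN u0M /andP[t0 tT].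
have [c cP] : {c : nat -> R -> R & forall k,
  (forall t : R, is_derive t 1 (c k) (- (m k * c k t) - ipV (W t) (Phi k))) /\
  (forall t, 0 <= t <= T -> c k t = ipV (U t) (Phi k)) /\ c k 0 = ip u0 (phi k)}.
  exact: (choice mild_solution_coef).
have Lu0 : L2 u0 by exact: C0_L2.
have Lphi := basis_L2 hphi.
have Lu s : L2 (u (clip T s)) by exact: C0_L2.
have hp := projection_residual_excessL2 mOmega M0.
have phi1 k : 0 < ip (phi k) (phi k).
  by have [_ -> _] := hphi; rewrite eqxx.
have lam0 k : 0 <= lam k := eigenvalue_ge0 (Lphi k) (phi1 k) (hlam k).
have orth := orthonormal_toL2 hphi.
have compl := basis_complete mOmega hphi.
have pu0 : nrm (excessL2 Omega M (toL2 u0)) = 0.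
  rewrite -(subr0 (excessL2 Omega M (toL2 u0))); apply: (nrm_subr_eq0 mOmega) => x Ox.
  rewrite excessL2E// toL2E//.
  by rewrite /excess clip_id ?subrr// u0M.
have U0 : nrm (U 0 - toL2 u0) = 0.
  have T00 : (0 : R) <= 0 <= T by rewrite lexx ltW.
  apply: (nrm_eq0_coef compl) => k; have [_ [h1 h2]] := cP k.
  by rewrite (ipBl hip) -(h1 0 T00) h2 ipL2_toL2// subrr.
have pU0 : nrm (excessL2 Omega M (U 0)) = 0.
  have h1 := nrm_residualB hip hp (U 0) (toL2 u0); rewrite U0 in h1.
  have h2 := ler_nrm_dist hip (excessL2 Omega M (U 0)) (excessL2 Omega M (toL2 u0)).
  rewrite pu0 subr0 in h2; apply/eqP; rewrite eq_le nrm_ge0 andbT.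
  exact: le_trans (ler_norm _) (le_trans h2 h1).
apply/eqP; rewrite eq_le nrm_ge0 andbT -pU0.
apply: (residual_nonincreasing hip orth compl hp (m := m) (U := U) (W := W) (c := c)).
- move=> n a.
  have h := residual_powR_ge0 hip hp (phi := Phi) halpha lam0
    (fun b => dirichlet_excess_ge0 oOmega bOmega n b M0 hlam) a.
  have -> : \sum_(k < n) (m k * a k) *: Phi k =
      eps ^+ 2 *: (\sum_(k < n) (lam k `^ alpha * a k) *: Phi k).
    by rewrite scaler_sumr; apply: eq_bigr => k _; rewrite scalerA mulrA.
  by rewrite (ipZl hip) mulr_ge0// sqr_ge0.
- exact: cvg_path.
- exact: cvg_path_reaction.
- by move=> k s; have [] := cP k.
- by move=> k s /andP[s0 st]; have [_ [h _]] := cP k; apply: h; rewrite s0 (le_trans st).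
- move=> s _; apply: ipL2_ge0 => x Ox; rewrite excessL2E// /U /W !toL2E//.
    exact: signN.
  exact: C0_comp_L2.
- exact: t0.
Qed.

End MildSolution.

(** * The maximum bound *)

Theorem theorem4p4 (R : realType) (Omega : set (R * R))
    (lam : nat -> R) (phi : nat -> R * R -> R)
    (alpha eps T u_minus u_m u_plus : R)
    (u0 : R * R -> R) (u : R -> R * R -> R)
    (hOmega : bounded_lipschitz_domain Omega)
    (hbasis : dirichlet_eigenbasis Omega lam phi)
    (halpha : 0 < alpha < 1) (heps : 0 < eps) (hT : 0 < T)
    (hpot : u_minus < u_m < u_plus)
    (hu0 : C0 Omega u0)
    (hu : mild_solution Omega lam phi alpha eps T
            (nonlinearity u_minus u_m u_plus) u0 u)
    (hbound : forall x, Omega x -> 0 <= u0 x <= u_plus - u_minus) :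
  let P := Omega `*` `]0, T]%classic in
  forall (x : R * R) (t : R), closure P (x, t) ->
    0 <= u t x <= u_plus - u_minus.
Proof.
move=> P x t Pxt; have [oO _ _ bO _] := hOmega; have [hlam hphi] := hbasis.
have M0 : 0 <= u_plus - u_minus by case/andP: hpot; lra.
have Ox : closure Omega x.
  move=> B xB; have [|[y s] [[/= Oy _] [/= By _]]] := Pxt (B `*` setT).
    by exists (B, setT) => //; split => //; exact: filterT.
  by exists y.
have tT : 0 <= t <= T.
  suff : closure `[0, T]%classic t.
    have clT : closed (`[0, T]%classic : set R) by exact: interval_closed.
    by rewrite -((closure_id _).1 clT) /= in_itv.
  move=> B tB; have [|[y s] [[/= _ sT] [/= _ Bs]]] := Pxt (setT `*` B).
    by exists (setT, B) => //; split => //; exact: filterT.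
  exists s; split => //; move: sT; rewrite /= !in_itv/= => /andP[s0 ->].
  by rewrite ltW.
have hut := hu.1.1 t tT.
have [xO|xO] := pselect (Omega x); last first.
  have -> : u t x = 0.
    by apply: hut.2; split => // /interior_subset.
  by rewrite lexx.
apply: (nrm_excess_eq0 oO bO M0 hut _ xO).
have := @mild_solution_invariant _ _ oO bO lam phi alpha eps T _ u0 u hphi hT hu0 hu
  (@continuous_nonlinearity _ _ _ _) (@nonlinearity_locally_lipschitz _ _ _ _)
  hlam halpha (u_plus - u_minus) t M0.
rewrite clip_id//; apply => //.
by move=> v; exact: nonlinearity_excess_ge0.
Qed.
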